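(* Let $\mathcal{L}\subset S^3$ be a stably Chebotarev link and let $h:M\to S^3$ be a cover in $\mathrm{Cov}(S^3,\mathcal{L})$. Let $\mathcal{L}'\subset\mathcal{L}_M$ be a subset which contains all but finitely many knot components of $\mathcal{L}_M$, and let $p$ be a prime number. Then the natural restriction map $$\phi^1:H^1(\mathrm{Gal}(M,\mathcal{L}_M),\mathbb{F}_p)\to\prod_{K\in\mathcal{L}'}H^1(D_{\overline{K}|K},\mathbb{F}_p)$$ is injective.
   Context: 3-manifolds are closed, connected and oriented, with base points (suppressed). Let $\mathcal{L}=\bigcup_{i\ge1}K_i$ be a countably infinite tame link in a 3-manifold $M$ with a fixed ordering of its components; put $L_n=\bigcup_{i\le n}K_i$. $\mathcal{L}$ is Chebotarev if for every $n\ge 0$, every surjective homomorphism $\rho:\pi_1(M\setminus L_n)\to G$ onto a finite group $G$ and every conjugacy class $C\subset G$, $\lim_{\nu\to\infty}\#\{n<j\le\nu:\rho([K_j])=C\}/\nu=\#C/\#G$, where $[K_j]$ is the conjugacy class of $K_j$ in $\pi_1(M\setminus L_n)$. $\mathrm{Cov}(M,\mathcal{L})$ is the category of finite (connected) branched covers of $M$ branched along a finite sublink of $\mathcal{L}$. For $h:N\to M$ in it, $\mathcal{L}_N:=h^{-1}(\mathcal{L})$. The link $\mathcal{L}$ carries the length function $\ell(K_i)=\ln p_i$ ($p_i$ the $i$-th prime); for a component $K'$ of $h^{-1}(K)$, $K\in\mathcal{L}$, put $\ell_h(K')=|D_{K'|K}|\cdot\ell(K)$, where $D_{K'|K}$ is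 the decomposition group (stabilizer of $K'$ among deck transformations, for $h$ Galois); when $K$ is unramified in $h$, $|D_{K'|K}|$ is the degree of the covering $K'\to K$. $\mathcal{L}_N$ is ordered by $\ell_h$. $\mathcal{L}$ is stably Chebotarev if it is Chebotarev and, for every $h:N\to M$ in $\mathrm{Cov}(M,\mathcal{L})$, $\mathcal{L}_N$ with this ordering is Chebotarev in $N$. $\mathrm{Cov}(S^3,\mathcal{L})$ is a Galois category; fix a universal branched pro-cover $\overline{S^3_{\mathcal{L}}}\to S^3$ (through which every cover in $\mathrm{Cov}(S^3,\mathcal{L})$ factors). $\mathrm{Gal}(S^3,\mathcal{L})$ is its profinite automorphism group over $S^3$. For $h:M\to S^3$ in $\mathrm{Cov}(S^3,\mathcal{L})$, $\mathrm{Gal}(M,\mathcal{L}_M)\cong\varprojlim_{L\subset\mathcal{L}_M\text{ finite}}\widehat{\pi}_1(M\setminus L)$ is the open subgroup of $\mathrm{Gal}(S^3,\mathcal{L})$ corresponding to $h$. For each $K\in\mathcal{L}_M$ a component $\overline{K}$ above $K$ in the universal pro-cover is chosen (a compatible choice of a component over $K$ in each cover in $\mathrm{Cov}(M,\mathcal{L}_M)$), and $D_{\overline{K}|K}=\{g\in\mathrm{Gal}(M,\mathcal{L}_M):g(\overline{K})=\overline{K}\}$. Cohomology is continuous cohomology of profinite groups, and $\mathbb{F}_p$ has trivial action. *)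

(* Defs.v *)
From HB Require Import structures.
From mathcomp Require Import all_boot all_order all_algebra all_fingroup.
From mathcomp Require Import generic_quotient ring_quotient.
From mathcomp Require Import all_classical all_reals all_analysis.
From mathcomp Require Import lra.

Set Implicit Arguments.
Unset Strict Implicit.
Unset Printing Implicit Defensive.

Import Order.TTheory GRing.Theory Num.Theory.
Import numFieldNormedType.Exports.

Local Open Scope classical_set_scope.
Local Open Scope ring_scope.
Local Open Scope quotient_scope.

Section Continuity.
Context {R : realType}.

Lemma continuous_compose (T U V : topologicalType) (f : T -> U) (g : U -> V) :
  continuous f -> continuous g -> continuous (fun x => g (f x)).
Proof. by move=> cf cg x; apply: continuous_comp; [exact: cf | exact: cg]. Qed.

Lemma paste_continuous (T U : topologicalType) (q : T -> R) (f g : T -> U) :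
  continuous q -> continuous f -> continuous g ->
  (forall u, q u = 2^-1 -> f u = g u) ->
  continuous (fun u => if q u <= 2^-1 then f u else g u).
Proof.
move=> cq cf cg fg; apply/continuous_closedP => W cW.
rewrite (_ : _ @^-1` W = (q @^-1` [set r | r <= 2^-1] `&` f @^-1` W)
                    `|` (q @^-1` [set r | 2^-1 <= r] `&` g @^-1` W)).
  apply: closedU; apply: closedI.
  - by apply: preimage_closed => [x _|]; [exact: cq | exact: closed_le].
  - by apply: preimage_closed => [x _|]; [exact: cf | exact: cW].
  - by apply: preimage_closed => [x _|]; [exact: cq | exact: closed_ge].
  - by apply: preimage_closed => [x _|]; [exact: cg | exact: cW].
apply/seteqP; split=> u /=.
  by case: leP => [qu fu|/ltW qu gu]; [left | right].
case: leP => qu [[+ +]|[+ +]] //.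
by move=> qu' gu; rewrite fg //; apply/eqP; rewrite eq_le qu qu'.
Qed.

Lemma affine_continuous (k l : R) : continuous (fun t : R => k * t + l).
Proof.
by move=> t; apply: cvgD; [apply: cvgMr; exact: cvg_id | exact: cvg_cst].
Qed.

Lemma fst_continuous (T U : topologicalType) : continuous (@fst T U).
Proof. by move=> x; exact: cvg_fst. Qed.

Lemma snd_continuous (T U : topologicalType) : continuous (@snd T U).
Proof. by move=> x; exact: cvg_snd. Qed.

Lemma pair_continuous (T U V : topologicalType) (f : T -> U) (g : T -> V) :
  continuous f -> continuous g -> continuous (fun x => (f x, g x)).
Proof. by move=> cf cg x; apply: cvg_pair; [exact: cf | exact: cg]. Qed.

End Continuity.

Lemma initial_continuous_into (T U : topologicalType) (S : choiceType)
    (v : S -> U) (f : T -> S) :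
  continuous (fun x => v (f x)) -> continuous (f : T -> initial_topology v).
Proof.
move=> /continuousP cf; apply/continuousP => _ [B oB <-].
by rewrite -comp_preimage; exact: cf.
Qed.

Section Paths.
Context {R : realType} {M : topologicalType} (A : set M).
Implicit Types (b x y z : M) (c d : R -> M).

(* A path is a continuous map defined on the whole real line, of which only   *)
(* the restriction to [0, 1] matters: precomposition with the retraction of   *)
(* the line onto [0, 1] shows that, up to [homotopic], these are the usual    *)
(* paths.  Paths and homotopies stay in the subspace [A] of [M].              *)
Definition is_path x y c :=
  [/\ continuous c, forall t, A (c t), c 0 = x & c 1 = y].

Definition homotopic c d := exists H : R * R -> M,
  [/\ continuous H, forall u, A (H u),
      forall t, H (0, t) = c t /\ H (1, t) = d t
    & forall s, H (s, 0) = c 0 /\ H (s, 1) = c 1].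

Definition path_cat c d : R -> M :=
  fun t => if t <= 2^-1 then c (2 * t) else d (2 * t - 1).

Definition path_rev c : R -> M := fun t => c (1 - t).

Lemma is_path_cst b : A b -> is_path b b (fun=> b).
Proof. by move=> Ab; split=> // x; exact: cvg_cst. Qed.

Lemma is_path_cat x y z c d :
  is_path x y c -> is_path y z d -> is_path x z (path_cat c d).
Proof.
move=> [cc Ac c0 c1] [cd Ad d0 d1]; split.
- apply: (@paste_continuous R R M id); first by move=> u; exact: cvg_id.
  + apply: (@continuous_compose R R M (fun t => 2 * t) c) => //.
    by move=> t; apply: cvgMr; exact: cvg_id.
  + exact: (@continuous_compose R R M _ d (@affine_continuous R 2 (-1))).
  + move=> u ->; rewrite (_ : 2 * 2^-1 = 1 :> R) ?subrr ?c1 ?d0 //.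
    by rewrite divff.
- by move=> t; rewrite /path_cat; case: ifP.
- by rewrite /path_cat invr_ge0 ler0n mulr0.
- rewrite /path_cat ifF; last by apply/negbTE; rewrite -ltNge; lra.
  by rewrite mulr1 (_ : 2 - 1 = 1 :> R) //; lra.
Qed.

Lemma is_path_rev x y c : is_path x y c -> is_path y x (path_rev c).
Proof.
move=> [cc Ac c0 c1]; split.
- apply: (@continuous_compose R R M (fun t => 1 - t) c) => // t.
  by apply: cvgB; [exact: cvg_cst | exact: cvg_id].
- by move=> t; exact: Ac.
- by rewrite /path_rev subr0.
- by rewrite /path_rev subrr.
Qed.

Lemma homotopic_refl x y c : is_path x y c -> homotopic c c.
Proof.
move=> [cc Ac _ _]; exists (fun u => c u.2); split=> //.
exact: (continuous_compose (@snd_continuous _ _) cc).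
Qed.

Lemma homotopic_sym x y c d :
  is_path x y c -> is_path x y d -> homotopic c d -> homotopic d c.
Proof.
move=> [cc Ac c0 c1] [cd Ad d0 d1] [H [cH AH H01 Hs]].
exists (fun u => H (1 - u.1, u.2)); split=> // [|t|s] /=.
- apply: continuous_compose cH; apply: pair_continuous.
    apply: (@continuous_compose _ R R fst (fun t => 1 - t)).
      exact: fst_continuous.
    by move=> t; apply: cvgB; [exact: cvg_cst | exact: cvg_id].
  exact: snd_continuous.
- by rewrite subr0 subrr; case: (H01 t).
- by case: (Hs (1 - s)) => -> ->; rewrite c0 c1 d0 d1.
Qed.

Lemma homotopic_trans c d e : homotopic c d -> homotopic d e -> homotopic c e.
Proof.
move=> [H [cH AH H01 Hs]] [G [cG AG G01 Gs]].
exists (fun u => if u.1 <= 2^-1 then H (2 * u.1, u.2) else G (2 * u.1 - 1, u.2)).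
split=> [|u|t|s] /=.
- apply: (@paste_continuous R (R * R)%type M fst); first exact: fst_continuous.
  + apply: continuous_compose cH; apply: pair_continuous.
      apply: (@continuous_compose _ R R fst (fun t => 2 * t)).
        exact: fst_continuous.
      by move=> t; apply: cvgMr; exact: cvg_id.
    exact: snd_continuous.
  + apply: continuous_compose cG; apply: pair_continuous.
      apply: (@continuous_compose _ R R fst (fun t => 2 * t - 1)).
        exact: fst_continuous.
      exact: affine_continuous.
    exact: snd_continuous.
  + move=> [s t] /= ->; rewrite divff // subrr.
    by rewrite (H01 t).2 (G01 t).1.
- by case: ifP.
- rewrite invr_ge0 ler0n mulr0 (H01 t).1; split=> //.
  rewrite ifF; last by apply/negbTE; rewrite -ltNge; lra.
  by rewrite (_ : 2 * 1 - 1 = 1 :> R) ?(G01 t).2 //; lra.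
- have cd0 : d 0 = c 0 by rewrite -(H01 0).2 (Hs 1).1.
  have cd1 : d 1 = c 1 by rewrite -(H01 1).2 (Hs 1).2.
  by case: ifP => _; rewrite ?(Hs _).1 ?(Hs _).2 ?(Gs _).1 ?(Gs _).2 ?cd0 ?cd1.
Qed.

Lemma homotopic_cat x y z c c' d d' : is_path x y c -> is_path y z d ->
  homotopic c c' -> homotopic d d' ->
  homotopic (path_cat c d) (path_cat c' d').
Proof.
move=> [cc Ac c0 c1] [cd Ad d0 d1] [H [cH AH H01 Hs]] [G [cG AG G01 Gs]].
exists (fun u => if u.2 <= 2^-1 then H (u.1, 2 * u.2) else G (u.1, 2 * u.2 - 1)).
split=> [|u|t|s] /=.
- apply: (@paste_continuous R (R * R)%type M snd); first exact: snd_continuous.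
  + apply: continuous_compose cH; apply: pair_continuous.
      exact: fst_continuous.
    apply: (@continuous_compose _ R R snd (fun t => 2 * t)).
      exact: snd_continuous.
    by move=> t; apply: cvgMr; exact: cvg_id.
  + apply: continuous_compose cG; apply: pair_continuous.
      exact: fst_continuous.
    apply: (@continuous_compose _ R R snd (fun t => 2 * t - 1)).
      exact: snd_continuous.
    exact: affine_continuous.
  + move=> [s t] /= ->; rewrite divff // subrr.
    by rewrite (Hs s).2 (Gs s).1 c1 d0.
- by case: ifP.
- rewrite /path_cat; case: ifP => _; first exact: H01.
  exact: G01.
- rewrite /path_cat invr_ge0 ler0n mulr0 (Hs s).1; split=> //.
  have F : (1 <= 2^-1 :> R) = false by apply/negbTE; rewrite -ltNge; lra.
  by rewrite F (_ : 2 * 1 - 1 = 1 :> R) ?(Gs s).2 //; lra.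
Qed.

Lemma homotopic_reparam x y c (f g : R -> R) : is_path x y c ->
  continuous f -> continuous g -> f 0 = g 0 -> f 1 = g 1 ->
  homotopic (c \o f) (c \o g).
Proof.
move=> [cc Ac _ _] cf cg fg0 fg1.
exists (fun u => c ((1 - u.1) * f u.2 + u.1 * g u.2)); split=> //= [|t|s].
- apply: (@continuous_compose _ R M
    (fun u : R * R => (1 - u.1) * f u.2 + u.1 * g u.2) c) => // u.
  apply: cvgD; apply: cvgM.
  + by apply: cvgB; [exact: cvg_cst | exact: fst_continuous].
  + exact: (continuous_compose (@snd_continuous _ _) cf).
  + exact: fst_continuous.
  + exact: (continuous_compose (@snd_continuous _ _) cg).
- by split; congr (c _); rewrite ?subr0 ?subrr; lra.
- by split; congr (c _); rewrite -?fg0 -?fg1; lra.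
Qed.

End Paths.

Section FundamentalGroup.
Context {R : realType} {M : topologicalType} (A : set M) (b : A).
Implicit Types c : R -> M.

Let b0 : M := val b.

Definition loop := set_type [set c : R -> M | is_path A b0 b0 c].

HB.instance Definition _ := Choice.on loop.

Lemma loopP (c : loop) : is_path A b0 b0 (val c).
Proof. exact: set_mem (valP c). Qed.

Definition mk_loop c (cP : is_path A b0 b0 c) : loop := exist _ c (mem_set cP).

Definition loop_rel (c d : loop) : bool := `[< homotopic A (val c) (val d) >].

Lemma loop_rel_refl : reflexive loop_rel.
Proof. by move=> c; apply/asboolP; exact: homotopic_refl (loopP c). Qed.

Lemma loop_rel_sym : symmetric loop_rel.
Proof.
move=> c d; apply/idP/idP => /asboolP h; apply/asboolP;
exact: homotopic_sym (loopP _) (loopP _) h.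
Qed.

Lemma loop_rel_trans : transitive loop_rel.
Proof.
by move=> d c e /asboolP h /asboolP k; apply/asboolP; exact: homotopic_trans h k.
Qed.

Canonical loop_equiv := EquivRel loop_rel loop_rel_refl loop_rel_sym loop_rel_trans.

Definition pi1 := {eq_quot loop_equiv}.
HB.instance Definition _ := Quotient.on pi1.
HB.instance Definition _ := Choice.on pi1.

Definition loop_class c (cP : is_path A b0 b0 c) : pi1 := \pi_pi1 (mk_loop cP).

Lemma loop_classP c d (cP : is_path A b0 b0 c) (dP : is_path A b0 b0 d) :
  loop_class cP = loop_class dP <-> homotopic A c d.
Proof.
by split=> [/eqmodP /asboolP // | h]; apply/eqmodP/asboolP.
Qed.

Let rP (x : pi1) : is_path A b0 b0 (val (repr x)) := loopP (repr x).

Lemma loop_class_repr (x : pi1) : loop_class (rP x) = x.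
Proof.
rewrite -[RHS]reprK; apply/eqmodP/asboolP; exact: homotopic_refl (rP x).
Qed.

Lemma pi1W (P : pi1 -> Prop) :
  (forall c (cP : is_path A b0 b0 c), P (loop_class cP)) -> forall x, P x.
Proof. by move=> h x; rewrite -[x]loop_class_repr. Qed.

Lemma base_in : A b0. Proof. exact: set_mem (valP b). Qed.

Definition pi1_one : pi1 := loop_class (is_path_cst base_in).

Definition pi1_mul (x y : pi1) : pi1 := loop_class (is_path_cat (rP x) (rP y)).

Definition pi1_inv (x : pi1) : pi1 := loop_class (is_path_rev (rP x)).

Lemma pi1_mulE c d (cP : is_path A b0 b0 c) (dP : is_path A b0 b0 d) :
  pi1_mul (loop_class cP) (loop_class dP) = loop_class (is_path_cat cP dP).
Proof.
apply/loop_classP; apply: (homotopic_cat (rP _) (rP _)).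
- by apply/(loop_classP (rP _) cP); exact: loop_class_repr.
- by apply/(loop_classP (rP _) dP); exact: loop_class_repr.
Qed.

Lemma pi1_mulA : associative pi1_mul.
Proof.
elim/pi1W=> c cP; elim/pi1W=> d dP; elim/pi1W=> e eP.
rewrite !pi1_mulE; apply/loop_classP.
pose f (t : R) := if t <= 2^-1 then
  (if 2 * t <= 2^-1 then 2 * t else t + 2^-1 * 2^-1) else 2^-1 * t + 2^-1.
have cf : continuous f.
  apply: (@paste_continuous R R R id); first by move=> u; exact: cvg_id.
  - apply: (@paste_continuous R R R (fun t => 2 * t)).
    + by move=> t; apply: cvgMr; exact: cvg_id.
    + by move=> t; apply: cvgMr; exact: cvg_id.
    + by move=> t; apply: cvgD; [exact: cvg_id | exact: cvg_cst].
    + by move=> u h; lra.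
  - exact: affine_continuous.
  - by move=> u ->; rewrite ifF; [lra | apply/negbTE; rewrite -ltNge; lra].
have -> : path_cat (path_cat c d) e = path_cat c (path_cat d e) \o f.
  apply/funext => t; rewrite /path_cat /f /=.
  case: (leP t 2^-1) => h1; last first.
    have -> : (2^-1 * t + 2^-1 <= 2^-1 :> R) = false.
      by apply/negbTE; rewrite -ltNge; lra.
    have -> : (2 * (2^-1 * t + 2^-1) - 1 <= 2^-1 :> R) = false.
      by apply/negbTE; rewrite -ltNge; lra.
    by congr (e _); lra.
  case: (leP (2 * t) 2^-1) => h2; first by rewrite h2.
  have -> : (t + 2^-1 * 2^-1 <= 2^-1 :> R) = false.
    by apply/negbTE; rewrite -ltNge; lra.
  have -> : 2 * (t + 2^-1 * 2^-1) - 1 <= 2^-1 :> R by lra.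
  by congr (d _); lra.
rewrite -[X in homotopic _ X _]/(path_cat c (path_cat d e) \o id).
apply: (homotopic_reparam (is_path_cat cP (is_path_cat dP eP))) => //=.
- by move=> u; exact: cvg_id.
- by rewrite /f mulr0 invr_ge0 ler0n.
- by rewrite /f ifF; [lra | apply/negbTE; rewrite -ltNge; lra].
Qed.

Lemma pi1_mul1 : left_id pi1_one pi1_mul.
Proof.
elim/pi1W=> c cP; rewrite pi1_mulE; apply/loop_classP.
pose f (t : R) := if t <= 2^-1 then 0 else 2 * t - 1.
have cf : continuous f.
  apply: (@paste_continuous R R R id); first by move=> u; exact: cvg_id.
  - by move=> u; exact: cvg_cst.
  - exact: affine_continuous.
  - by move=> u ->; lra.
have -> : path_cat (fun=> b0) c = c \o f.
  apply/funext => t; rewrite /path_cat /f /=; case: ifP => // _.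
  by case: cP.
rewrite -[X in homotopic _ _ X]/(c \o id).
apply: (homotopic_reparam cP) => //=.
- by move=> u; exact: cvg_id.
- by rewrite /f invr_ge0 ler0n.
- by rewrite /f ifF; [lra | apply/negbTE; rewrite -ltNge; lra].
Qed.

Lemma pi1_mulr1 : right_id pi1_one pi1_mul.
Proof.
elim/pi1W=> c cP; rewrite pi1_mulE; apply/loop_classP.
pose f (t : R) := if t <= 2^-1 then 2 * t else 1.
have cf : continuous f.
  apply: (@paste_continuous R R R id); first by move=> u; exact: cvg_id.
  - by move=> t; apply: cvgMr; exact: cvg_id.
  - by move=> u; exact: cvg_cst.
  - by move=> u ->; lra.
have -> : path_cat c (fun=> b0) = c \o f.
  apply/funext => t; rewrite /path_cat /f /=; case: ifP => // _.
  by case: cP.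
rewrite -[X in homotopic _ _ X]/(c \o id).
apply: (homotopic_reparam cP) => //=.
- by move=> u; exact: cvg_id.
- by rewrite /f mulr0 invr_ge0 ler0n.
- by rewrite /f ifF //; apply/negbTE; rewrite -ltNge; lra.
Qed.

Lemma loop_revl c (cP : is_path A b0 b0 c) :
  homotopic A (path_cat (path_rev c) c) (fun=> b0).
Proof.
pose f (t : R) := if t <= 2^-1 then - 2 * t + 1 else 2 * t - 1.
have cf : continuous f.
  apply: (@paste_continuous R R R id); first by move=> u; exact: cvg_id.
  - exact: affine_continuous.
  - exact: affine_continuous.
  - by move=> u ->; lra.
have -> : path_cat (path_rev c) c = c \o f.
  apply/funext => t; rewrite /path_cat /path_rev /f /=; case: ifP => // _.
  by congr (c _); lra.
have -> : (fun=> b0) = c \o (fun _ : R => 1 : R).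
  by apply/funext => t /=; case: cP.
apply: (homotopic_reparam cP) => //=.
- by move=> u; exact: cvg_cst.
- by rewrite /f invr_ge0 ler0n mulr0 add0r.
- by rewrite /f ifF; [lra | apply/negbTE; rewrite -ltNge; lra].
Qed.

Lemma path_revK : involutive (@path_rev R M).
Proof. by move=> c; apply/funext => t; rewrite /path_rev opprB addrC subrK. Qed.

Lemma pi1_mulV : left_inverse pi1_one pi1_inv pi1_mul.
Proof.
move=> x; rewrite -[X in pi1_mul _ X]loop_class_repr pi1_mulE.
by apply/loop_classP; exact: loop_revl (rP x).
Qed.

Lemma pi1_mulVr : right_inverse pi1_one pi1_inv pi1_mul.
Proof.
move=> x; rewrite -[X in pi1_mul X _]loop_class_repr pi1_mulE.
apply/loop_classP; rewrite -[X in path_cat X _]path_revK.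
exact: loop_revl (is_path_rev (rP x)).
Qed.

HB.instance Definition _ :=
  isGroup.Build pi1 pi1_mulA pi1_mul1 pi1_mulr1 pi1_mulV pi1_mulVr.

End FundamentalGroup.

HB.mixin Record isTopologicalGroup G of monoid.Group G & Topological G := {
  mulg_continuous : continuous (fun u : G * G => (u.1 * u.2)%g);
  invg_continuous : continuous (fun u : G => (u^-1)%g)
}.

#[short(type="topologicalGroupType")]
HB.structure Definition TopologicalGroup :=
  {G of isTopologicalGroup G & monoid.Group G & Topological G}.

Record subgroup (G : topologicalGroupType) := Subgroup {
  subgroup_set :> set G;
  subgroup1 : subgroup_set 1%g;
  subgroupV : forall x, subgroup_set x -> subgroup_set (x^-1)%g;
  subgroupM : forall x y,
    subgroup_set x -> subgroup_set y -> subgroup_set (x * y)%g }.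

Section Subgroup.
Context (G : topologicalGroupType) (H : subgroup G).

Definition subgroup_type := set_type (subgroup_set H).

HB.instance Definition _ := SubChoice.on subgroup_type.
HB.instance Definition _ := Topological.on subgroup_type.

Lemma subgroup_group_closed : group_closed (mem (subgroup_set H)).
Proof.
split=> [|x y]; rewrite !inE; first exact: subgroup1.
by move=> Hx Hy; apply: subgroupM => //; exact: subgroupV.
Qed.

HB.instance Definition _ :=
  SubChoice_isSubGroup.Build G _ subgroup_type subgroup_group_closed.

Lemma subgroup_val_continuous : continuous (val : subgroup_type -> G).
Proof. exact: initial_continuous. Qed.

Lemma subgroup_mulg_continuous :
  continuous (fun u : subgroup_type * subgroup_type => (u.1 * u.2)%g).
Proof.
apply: initial_continuous_into.
have cv := @subgroup_val_continuous.
pose g (u : subgroup_type * subgroup_type) := (val u.1, val u.2).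
have cg : continuous g.
  apply: pair_continuous.
    exact: (continuous_compose (@fst_continuous _ _) cv).
  exact: (continuous_compose (@snd_continuous _ _) cv).
exact: (continuous_compose cg (@mulg_continuous G)).
Qed.

Lemma subgroup_invg_continuous :
  continuous (fun u : subgroup_type => (u^-1)%g).
Proof.
apply: initial_continuous_into.
exact: (continuous_compose subgroup_val_continuous (@invg_continuous G)).
Qed.

HB.instance Definition _ := isTopologicalGroup.Build subgroup_type
  subgroup_mulg_continuous subgroup_invg_continuous.

End Subgroup.

Lemma discrete_continuousP (T : topologicalType) (D : choiceType)
    (f : T -> discrete_topology D) :
  continuous f <-> forall x, \forall y \near x, f y = f x.
Proof.
split=> [cf x | cf x U /principal_filterP Ux].
  by apply: (cf x [set f x]); exact/principal_filterP.
by apply: filterS (cf x) => y /= ->.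
Qed.

Lemma discrete_continuous2 (T : topologicalType) (D E F : choiceType)
    (h : D -> E -> F) (f : T -> discrete_topology D)
    (g : T -> discrete_topology E) : continuous f -> continuous g ->
  continuous ((fun x => h (f x) (g x)) : T -> discrete_topology F).
Proof.
move=> /discrete_continuousP cf /discrete_continuousP cg.
apply/discrete_continuousP => x; near=> y => /=.
by congr (h _ _); near: y; [exact: cf | exact: cg].
Unshelve. all: by end_near. Qed.

(* Continuous cohomology in degree 1 with coefficients in a discrete module.  *)
Section Cohomology.
Context (G : topologicalGroupType) (A : zmodType) (act : G -> {additive A -> A}).

Definition cocycle1 : {pred G -> A} := fun f =>
  `[< continuous (f : G -> discrete_topology A)
    /\ forall x y, f (x * y)%g = f x + act x (f y) >].

Lemma cocycle1_zmod_closed : zmod_closed cocycle1.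
Proof.
split=> [|f g].
  apply/asboolP; split=> [x|x y]; first exact: cvg_cst.
  by rewrite raddf0 addr0.
move=> /asboolP[cf fM] /asboolP[cg gM]; apply/asboolP; split=> [x|x y].
  exact: (discrete_continuous2 (h := fun a b => a - b) cf cg).
by rewrite !fctE fM gM raddfB opprD addrACA.
Qed.

HB.instance Definition _ := GRing.isZmodClosed.Build _ cocycle1 cocycle1_zmod_closed.

Definition Z1 := {f : G -> A | f \in cocycle1}.
HB.instance Definition _ := SubChoice.on Z1.
HB.instance Definition _ := [SubChoice_isSubZmodule of Z1 by <:].

Definition coboundary1 : {pred Z1} := fun f =>
  `[< exists a : A, forall x, val f x = act x a - a >].

Lemma coboundary1_zmod_closed : zmod_closed coboundary1.
Proof.
split=> [|f g]; first by apply/asboolP; exists 0 => x; rewrite raddf0 subrr.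
move=> /asboolP[a fE] /asboolP[b gE]; apply/asboolP; exists (a - b) => x.
have -> : val (f - g) = (val f - val g : G -> A) by exact: raddfB.
by rewrite -[LHS]/(val f x - val g x) fE gE (raddfB (act x)) !opprD addrACA.
Qed.

HB.instance Definition _ := GRing.isZmodClosed.Build _ coboundary1 coboundary1_zmod_closed.

Definition H1 := Quotient.quot coboundary1.
HB.instance Definition _ := GRing.Zmodule.on H1.
HB.instance Definition _ := Quotient.on H1.
End Cohomology.

Section Restriction.
Context (G : topologicalGroupType) (H : subgroup G) (A : zmodType).
Context (act : G -> {additive A -> A}).

Let actH (x : subgroup_type H) := act (val x).

Lemma cocycle1_res (f : Z1 act) : (val f \o val) \in cocycle1 actH.
Proof.
have /asboolP[cf fM] := valP f; apply/asboolP; split=> [|x y]; last first.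
  exact: (fM (val x) (val y)).
exact: (continuous_compose (@subgroup_val_continuous G H) cf).
Qed.

Definition res_cocycle (f : Z1 act) : Z1 actH := Sub (val f \o val) (cocycle1_res f).

Definition res1 (c : H1 act) : H1 actH := \pi_(H1 actH) (res_cocycle (repr c)).

Lemma res1E (f : Z1 act) :
  res1 (\pi_(H1 act) f) = \pi_(H1 actH) (res_cocycle f).
Proof.
apply/eqP; rewrite -Quotient.idealrBE.
have : repr (\pi_(H1 act) f) - f \in @coboundary1 _ _ act.
  by rewrite Quotient.idealrBE reprK.
move=> /asboolP[a aE]; apply/asboolP; exists a => x.
exact: (aE (val x)).
Qed.
End Restriction.

Definition trivial_action (G : Type) (A : zmodType) : G -> {additive A -> A} :=
  fun=> idfun.

Definition open_map (T U : topologicalType) (e : T -> U) :=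
  forall W, open W -> open (e @` W).

Definition open_embedding (T U : topologicalType) (e : T -> U) :=
  [/\ continuous e, injective e & open_map e].

(* No orientation is recorded: only the 3-sphere and its branched covers along *)
(* tame links will occur, and an orientation of the base pulls back to them.   *)
Definition closed_3manifold (R : realType) (M : topologicalType) :=
  [/\ hausdorff_space M, compact [set: M], connected [set: M], [set: M] !=set0
    & forall x : M, exists e : R * R * R -> M, open_embedding e /\ range e x].

Definition sphere3 (R : realType) :=
  set_type [set x : 'rV[R]_4 | \sum_i x 0 i ^+ 2 = 1].
HB.instance Definition _ (R : realType) := Topological.on (sphere3 R).

Section Links.
Context {R : realType} {M : topologicalType}.

(* An oriented knot is parametrized by R/Z. *)
Definition knot (k : R -> M) :=
  continuous k /\ forall s t, k s = k t <-> s - t \is a Num.int.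

(* [E] is an open tubular neighbourhood R^2 x R/Z whose core is [k]. *)
Definition tame_knot (k : R -> M) := knot k /\
  exists E : R * R * R -> M,
    [/\ continuous E, open_map E,
        forall z w s t, E (z, s) = E (w, t) <-> z = w /\ s - t \is a Num.int
      & forall t, E (0, t) = k t].

Definition tame_link (K : nat -> R -> M) :=
  (forall i, tame_knot (K i)) /\ trivIset setT (fun i => range (K i)).

Definition sublink (K : nat -> R -> M) (n : nat) : set M :=
  \bigcup_(i in `I_n) range (K i).

(* The conjugacy class of [k] in the fundamental group of [A]; it is empty if  *)
(* [k] leaves [A].                                                            *)
Definition knot_class (A : set M) (b : A) (k : R -> M) : set (@pi1 R M A b) :=
  [set x | exists tau, is_path A (val b) (k 0) tau /\
     exists cP : is_path A (val b) (val b)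
                   (path_cat (path_cat tau k) (path_rev tau)),
       x = loop_class cP].
Arguments knot_class {A} b k _.

Definition chebotarev (K : nat -> R -> M) :=
  forall (n : nat) (b : ~` sublink K n) (G : finGroupType)
         (rho : @pi1 R M (~` sublink K n) b -> G),
    {morph rho : x y / (x * y)%g} -> range rho = setT ->
  forall C : {set G}, C \in classes [set: G]%SET ->
  (fun nu : nat =>
     (\sum_(n <= j < nu) `[< rho @` knot_class b (K j) = [set` C] >])%N%:R
       / nu%:R : R)
    @ \oo --> (#|C|%:R / #|{: G}|%:R : R).

End Links.

Lemma next_prime_subproof (m : nat) : exists q, (m < q)%N && prime q.
Proof. by have [q mq q_pr] := prime_above m; exists q; rewrite mq. Qed.

Definition next_prime (m : nat) : nat := ex_minn (next_prime_subproof m).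

Definition nth_prime (i : nat) : nat := iter i next_prime 2%N.

Section BranchedCovers.
Context {R : realType} {N M : topologicalType}.
Implicit Types (h : N -> M) (g : N -> N).

Definition complex_mul (z w : R * R) : R * R :=
  (z.1 * w.1 - z.2 * w.2, z.1 * w.2 + z.2 * w.1).

Definition complex_exp (z : R * R) (e : nat) : R * R :=
  iter e (complex_mul z) (1, 0).

Definition finite_covering_over h (A : set M) := forall x, A x ->
  exists U, [/\ open U, U x & U `<=` A] /\
  exists (d : nat) (V : 'I_d -> set N),
    [/\ trivIset setT V, h @^-1` U = \bigcup_i V i, forall i, open (V i),
        forall i, set_bij (V i) U h
      & forall i W, open W -> W `<=` V i -> open (h @` W)].

(* Near a point above the branch locus, [h] is (z, t) |-> (z ^ e, t) in local *)
(* coordinates C x R in which the branch locus is 0 x R. *)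
Definition branched_cover_along h (L : set M) :=
  [/\ continuous h, finite_covering_over h (~` L)
    & forall y, L (h y) -> exists (e : nat) (phi : R * R * R -> N)
        (psi : R * R * R -> M),
        [/\ (0 < e)%N, open_embedding phi /\ open_embedding psi, phi (0, 0) = y,
            forall z t, L (psi (z, t)) <-> z = 0
          & forall z t, h (phi (z, t)) = psi (complex_exp z e, t)]].

Definition cov (K : nat -> R -> M) h :=
  closed_3manifold R N /\ exists n, branched_cover_along h (sublink K n).

Definition deck h : set (N -> N) :=
  [set g | [/\ continuous g, forall x, h (g x) = h x
    & exists g', [/\ continuous g', cancel g g' & cancel g' g]]].

Definition galois_cover h :=
  forall x y, h x = h y -> exists2 g, deck h g & g x = y.

(* The preimage of the whole link may have larger connected components than   *)
(* the preimages of the individual knots, whence the index [i]. *)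
Definition knot_components (K : nat -> R -> M) h : set (set N) :=
  [set C | exists i x, range (K i) (h x) /\
             C = connected_component (h @^-1` range (K i)) x].

(* [d] is the order of the decomposition group of the knot component [C],     *)
(* where [C] covers its image with degree [f].  For a cover that is not       *)
(* Galois, the degree [f] replaces it; [C] is then unramified, except for     *)
(* finitely many [C], which do not affect densities.                          *)
Definition decomposition_order h (C : set N) (f d : nat) :=
  (galois_cover h -> ([set g | deck h g /\ g @` C = C] #= `I_d)%card) /\
  (~ galois_cover h -> d = f).

(* The knot [k'] is oriented by [k] and covers it with degree [f]. *)
Definition covers_knot h (k : R -> M) (k' : R -> N) (f : nat) :=
  [/\ knot k', (0 < f)%N & forall t, h (k' t) = k (f%:R * t)].

(* [K'] enumerates the components of the preimage of the link in the order of *)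
(* their length, the [i]-th knot of the base having length ln p_i.  Ties, of  *)
(* bounded size, are broken arbitrarily: they do not affect densities.        *)
Definition preimage_link (K : nat -> R -> M) h (K' : nat -> R -> N) :=
  exists i f d : nat -> nat,
  [/\ set_bij setT (knot_components K h) (fun j => range (K' j)),
      forall j, covers_knot h (K (i j)) (K' j) (f j),
      forall j, decomposition_order h (range (K' j)) (f j) (d j)
    & forall j k, (j <= k)%N ->
        (d j)%:R * ln ((nth_prime (i j))%:R : R) <=
        (d k)%:R * ln ((nth_prime (i k))%:R : R)].

End BranchedCovers.

Definition stably_chebotarev (R : realType) (M : topologicalType)
    (K : nat -> R -> M) :=
  chebotarev K /\
  forall (N : topologicalType) (h : N -> M), cov K h ->
    exists2 K' : nat -> R -> N, preimage_link K h K' & chebotarev K'.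

(* A universal pro-cover is presented as a directed system of Galois covers,  *)
(* cofinal among all covers; its automorphisms are then the compatible        *)
(* families of deck transformations.                                          *)
Record pro_cover (M : topologicalType) := ProCover {
  pc_index : Type;
  pc_le : pc_index -> pc_index -> Prop;
  pc_space : pc_index -> topologicalType;
  pc_map : forall i, pc_space i -> M;
  pc_trans : forall i j, pc_le i j -> pc_space j -> pc_space i }.

Arguments pc_space {M} p i.
Arguments pc_map {M} p i.
Arguments pc_trans {M} p {i j}.

Definition universal_pro_cover (R : realType) (M : topologicalType)
    (K : nat -> R -> M) (P : pro_cover M) :=
  [/\ (forall i : pc_index P, pc_le i i) /\
      (forall i j k : pc_index P, pc_le i j -> pc_le j k -> pc_le i k) /\
      (forall i j : pc_index P, exists k, pc_le i k /\ pc_le j k),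
      forall i, cov K (pc_map P i) /\ galois_cover (pc_map P i),
      forall i j (ij : pc_le i j), continuous (pc_trans P ij) /\
        forall x, pc_map P i (pc_trans P ij x) = pc_map P j x,
      (forall i (ii : pc_le i i) x, pc_trans P ii x = x) /\
      (forall i j k (ij : pc_le i j) (jk : pc_le j k) (ik : pc_le i k) x,
        pc_trans P ij (pc_trans P jk x) = pc_trans P ik x)
    & forall (N : topologicalType) (h : N -> M), cov K h ->
        exists i (q : pc_space P i -> N),
          continuous q /\ forall x, h (q x) = pc_map P i x].

Section GaloisGroup.
Context {M : topologicalType} (P : pro_cover M).

Local Notation X := (pc_space P).

Definition pro_deck :
    set (prod_topology (fun i => discrete_topology (X i -> X i))) :=
  [set g | (forall i, deck (pc_map P i) (g i)) /\
    forall i j (ij : pc_le i j) x,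
      pc_trans P ij (g j x) = g i (pc_trans P ij x)].

(* Profinite topology: inherited from the product of discrete spaces. *)
Definition Gal := set_type pro_deck.
HB.instance Definition _ := Topological.on Gal.

Definition Gal_at (g : Gal) (i : pc_index P) : X i -> X i := val g i.
Arguments Gal_at g i _ : clear implicits.

Lemma GalP (g : Gal) : pro_deck (val g).
Proof. exact: set_mem (valP g). Qed.

Definition mk_Gal (g : forall i, X i -> X i) (gP : pro_deck g) : Gal :=
  exist (fun g => g \in pro_deck) g (mem_set gP).

Lemma Gal_eq (g g' : Gal) : (forall i x, Gal_at g i x = Gal_at g' i x) -> g = g'.
Proof.
by move=> gg'; apply/val_inj/functional_extensionality_dep => i; apply/funext.
Qed.

Lemma Gal_one_subproof : pro_deck (fun i => id).
Proof.
split=> // i; split=> // [x|]; first exact: cvg_id.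
by exists id; split=> // x; exact: cvg_id.
Qed.

Lemma Gal_mul_subproof (g g' : Gal) : pro_deck (fun i => Gal_at g i \o Gal_at g' i).
Proof.
have [dg cg] := GalP g; have [dg' cg'] := GalP g'; split=> [i|i j ij x /=].
  have [c m [u [cu gu ug]]] := dg i; have [c' m' [u' [cu' gu' ug']]] := dg' i.
  split=> [|x|]; first exact: (continuous_compose c' c).
    by rewrite /= [LHS]m.
  exists (u' \o u); split; first exact: (continuous_compose cu cu').
    exact: can_comp gu gu'.
  exact: can_comp ug' ug.
by rewrite [LHS]cg [X in _ X = _]cg'.
Qed.

Lemma Gal_inv_subproof (g : Gal) : {g' : Gal |
  forall i, cancel (Gal_at g i) (Gal_at g' i) /\ cancel (Gal_at g' i) (Gal_at g i)}.
Proof.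
have [dg cg] := GalP g.
have inv i : {u : X i -> X i | [/\ continuous u, cancel (Gal_at g i) u
                                   & cancel u (Gal_at g i)]}.
  by apply: cid; have [_ _] := dg i.
have uP : pro_deck (fun i => sval (inv i)).
  split=> [i|i j ij x].
    have [_ m _] := dg i; case: (inv i) => u [cu gu ug] /=.
    split=> // [x|]; first by rewrite -[LHS]m [X in pc_map _ _ X]ug.
    exists (Gal_at g i); split=> //; by have [] := dg i.
  case: (inv i) => u [cu gu ug] /=; case: (inv j) => v [cv gv vg] /=.
  by rewrite -[LHS]gu; congr u; rewrite -[LHS]cg [X in pc_trans _ _ X]vg.
by exists (mk_Gal uP) => i; rewrite /Gal_at /=; case: (inv i) => u [].
Qed.

Definition Gal_one : Gal := mk_Gal Gal_one_subproof.
Definition Gal_mul (g g' : Gal) : Gal := mk_Gal (Gal_mul_subproof g g').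
Definition Gal_inv (g : Gal) : Gal := sval (Gal_inv_subproof g).

Lemma Gal_mulA : associative Gal_mul. Proof. by move=> *; apply: Gal_eq. Qed.
Lemma Gal_mul1g : left_id Gal_one Gal_mul.
Proof. by move=> *; apply: Gal_eq. Qed.
Lemma Gal_mulg1 : right_id Gal_one Gal_mul.
Proof. by move=> *; apply: Gal_eq. Qed.
Lemma Gal_cancel (g : Gal) i : cancel (Gal_at g i) (Gal_at (Gal_inv g) i) /\
  cancel (Gal_at (Gal_inv g) i) (Gal_at g i).
Proof. exact: (svalP (Gal_inv_subproof g)). Qed.
Lemma Gal_mulVg : left_inverse Gal_one Gal_inv Gal_mul.
Proof. by move=> g; apply: Gal_eq => i; exact: (Gal_cancel g i).1. Qed.
Lemma Gal_mulgV : right_inverse Gal_one Gal_inv Gal_mul.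
Proof. by move=> g; apply: Gal_eq => i; exact: (Gal_cancel g i).2. Qed.

HB.instance Definition _ :=
  isGroup.Build Gal Gal_mulA Gal_mul1g Gal_mulg1 Gal_mulVg Gal_mulgV.

Lemma Gal_at_continuous i :
  continuous ((fun g => Gal_at g i) : Gal -> discrete_topology (X i -> X i)).
Proof.
have cv := @initial_continuous Gal _ (set_val : Gal -> _).
pose Y := fun j => discrete_topology (X j -> X j).
move=> g U Ui; apply: (cv g [set f : prod_topology Y | U (f i)]).
have h := (@cvg_sup _ _ (fun j => Topological.class
  (initial_topology (fun f : prod_topology Y => f j))) (nbhs (val g))
  (val g) _).1 cvg_id i.
apply: h.
exact: (@initial_continuous _ _ (fun f : prod_topology Y => f i) (val g) U Ui).
Qed.

Lemma Gal_continuous (T : topologicalType) (f : T -> Gal) :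
  (forall i, continuous ((fun x => Gal_at (f x) i) :
                            T -> discrete_topology (X i -> X i))) ->
  continuous f.
Proof.
move=> cf; apply: initial_continuous_into => x.
apply/cvg_sup => i.
exact: (@initial_continuous_into _ _ _ _ (fun x => val (f x)) (cf i)).
Qed.

Lemma Gal_mulg_continuous : continuous (fun u : Gal * Gal => (u.1 * u.2)%g).
Proof.
apply: Gal_continuous => i.
apply: (discrete_continuous2 (h := fun a b : X i -> X i => a \o b)
  (f := fun u : Gal * Gal => Gal_at u.1 i) (g := fun u => Gal_at u.2 i)).
- exact: (continuous_compose (@fst_continuous _ _) (@Gal_at_continuous i)).
- exact: (continuous_compose (@snd_continuous _ _) (@Gal_at_continuous i)).
Qed.

Lemma Gal_invg_continuous : continuous (fun u : Gal => (u^-1)%g).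
Proof.
apply: Gal_continuous => i; apply/discrete_continuousP => g.
have /discrete_continuousP/(_ g) := @Gal_at_continuous i.
apply: filterS => g' gg'; apply/funext => x.
rewrite -{1}[x](_ : Gal_at g i (Gal_at g^-1%g i x) = x).
  by rewrite -gg'; exact: (Gal_cancel g' i).1.
exact: (Gal_cancel g i).2.
Qed.

HB.instance Definition _ := isTopologicalGroup.Build Gal
  Gal_mulg_continuous Gal_invg_continuous.

Section Over.
Context (N : Type) (i : pc_index P) (q : X i -> N).

Definition over_set : set Gal := [set g | forall x, q (Gal_at g i x) = q x].

Lemma over_set1 : over_set 1%g. Proof. by []. Qed.

Lemma over_setV g : over_set g -> over_set (g^-1)%g.
Proof. by move=> gq x; rewrite -gq (Gal_cancel g i).2. Qed.

Lemma over_setM g g' : over_set g -> over_set g' -> over_set (g * g')%g.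
Proof. by move=> gq gq' x; exact: (etrans (gq _) (gq' x)). Qed.

(* The open subgroup of [Gal] corresponding to a cover [N] of [M], for the    *)
(* choice of a factorization [q] of the universal pro-cover through [N].      *)
Definition Gal_over : subgroup Gal := Subgroup over_set1 over_setV over_setM.
End Over.

Section Stabilizer.
Context (H : subgroup Gal) (C : forall i, set (X i)).
Arguments C i _ : clear implicits.

Definition stab_set : set (subgroup_type H) :=
  [set g | forall i, Gal_at (val g) i @` C i = C i].

Lemma stab_set1 : stab_set 1%g.
Proof. by move=> i; exact: image_id. Qed.

Lemma stab_setV g : stab_set g -> stab_set (g^-1)%g.
Proof.
move=> gC i; rewrite -{1}(gC i) image_comp -[RHS]image_id.
by apply: eq_imagel => x _; exact: (Gal_cancel (val g) i).1.
Qed.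

Lemma stab_setM g g' : stab_set g -> stab_set g' -> stab_set (g * g')%g.
Proof. by move=> gC gC' i; rewrite -{2}(gC i) -{2}(gC' i) image_comp. Qed.

(* [C] is a component of the pro-cover, given by its image at each level. *)
Definition stabilizer : subgroup (subgroup_type H) :=
  Subgroup stab_set1 stab_setV stab_setM.
End Stabilizer.

End GaloisGroup.

Definition component_above (R : realType) (M N : topologicalType)
    (K : nat -> R -> M) (P : pro_cover M) (i0 : pc_index P)
    (q : pc_space P i0 -> N) (C : set N) (Cbar : forall i, set (pc_space P i)) :=
  [/\ forall i, knot_components K (pc_map P i) (Cbar i),
      forall i j (ij : pc_le i j), pc_trans P ij @` Cbar j = Cbar i
    & q @` Cbar i0 = C].

(* Main.v *)
(* A class in H^1 with trivial action is a continuous homomorphism phi from    *)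
(* Gal(M) to F_p.  By continuity it factors through the deck group of a single *)
(* level X of the pro-cover, and lifting loops of M minus a large finite       *)
(* sublink to X turns it into a homomorphism rho from the fundamental group    *)
(* to F_p, which is onto if phi <> 0.  By the Chebotarev property, infinitely  *)
(* many knots K, hence some K in L', have rho([K]) <> 0.  The deck             *)
(* transformation attached to such a K maps the start of a lift of K to its    *)
(* end, so it stabilizes the component of the preimage of K containing this    *)
(* lift; as K is unramified in X, a compactness argument extends it to an      *)
(* element of the decomposition group of K, on which phi is not zero.          *)

Require Import Defs.
From HB Require Import structures.
From mathcomp Require Import all_boot all_order all_algebra all_fingroup.
From mathcomp Require Import all_classical all_reals all_analysis.
From mathcomp Require Import generic_quotient ring_quotient ring lra zify.

Set Implicit Arguments.
Unset Strict Implicit.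
Unset Printing Implicit Defensive.

Import Order.TTheory GRing.Theory Num.Theory.
Import numFieldNormedType.Exports.

Local Open Scope classical_set_scope.
Local Open Scope ring_scope.

(** * Lifting paths and homotopies *)

(** For trivial coefficients every coboundary vanishes, so injectivity says that a continuous
    homomorphism [phi] from the group of [M] to ['F_p] which is zero on all chosen decomposition
    groups is zero ([character_vanishes]).

    Three ingredients carry this. The first is rigidity ([rigid]): two maps of branched covers that
    agree at one point off the branch locus agree everywhere. It rests on unique path lifting and on
    the fact that the preimage of a finite sublink, being of codimension two, does not disconnect a
    cover ([thin_branch], [thin_joined]). With the Galois property it lets deck transformations
    restrict and extend between levels.

    The second is a passage to the limit ([Gal_limit]): since fibres are finite, compatible lifts to
    all levels exist. In particular, a deck transformation of one level that stabilizes an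
    unramified component comes from the decomposition group ([Gal_stab_extend]).

    The third is monodromy. By [Gal_level], [phi] depends only on one level [k]; lifting loops to
    that level gives a homomorphism [rho] from the fundamental group of a link complement in [M] to
    ['F_p], onto if [phi] is nonzero. The Chebotarev property yields arbitrarily late knots on which
    [rho] takes the value 1, and [frobenius_stab] realizes this value on the decomposition group of
    such a knot. *)

Lemma connected_real (R : realType) : connected [set: R].
Proof. by apply/connected_intervalP. Qed.

Lemma connected_clopenT (T : topologicalType) (E : set T) :
  connected [set: T] -> open E -> open (~` E) -> E !=set0 -> forall x, E x.
Proof.
move=> cT oE oEC E0 x; suff -> : E = setT by [].
apply: cT => //; first by exists E; rewrite ?setTI.
by exists E; rewrite ?setTI // -[E]setCK; exact: open_closedC.
Qed.

Lemma hausdorff_sep (T : topologicalType) (x y : T) : hausdorff_space T ->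
  x <> y -> exists U V,
    [/\ open U /\ open V, U x, V y & forall z, U z -> V z -> False].
Proof.
rewrite open_hausdorff => hT /eqP /hT[[U V] /= []]; rewrite !inE => Ux Vy [oU oV UV].
exists U, V; split=> // z Uz Vz.
by have : (U `&` V) z by []; rewrite UV.
Qed.

Lemma paste_at {R : realType} (T U : topologicalType) (q : T -> R) (f g : T -> U)
    (t : R) (x : T) :
  {for x, continuous q} -> {for x, continuous f} -> {for x, continuous g} ->
  (q x = t -> f x = g x) ->
  {for x, continuous (fun y => if q y <= t then f y else g y)}.
Proof.
rewrite /prop_for /continuous_at => cq cf cg fg.
case: (ltgtP (q x) t) => qx.
- apply: cvg_trans cf; apply: near_eq_cvg.
  have : \forall y \near x, q y < t by exact: (cq [set r | r < t] (lt_nbhsl qx)).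
  by apply: filterS => y /ltW ->.
- apply: cvg_trans cg; apply: near_eq_cvg.
  have : \forall y \near x, t < q y by exact: (cq [set r | t < r] (lt_nbhsr qx)).
  by apply: filterS => y /lt_geF ->.
- move=> O /= Ox; have Ox' : nbhs (g x) O by rewrite -fg.
  have fgO : nbhs x (f @^-1` O `&` g @^-1` O).
    by apply: filterI; [exact: cf | exact: cg].
  by apply: filterS fgO => y [] /=; case: ifP.
Qed.

Lemma min_continuous_at (R : realType) (T : topologicalType) (f g : T -> R) x :
  {for x, continuous f} -> {for x, continuous g} ->
  {for x, continuous (fun y => Num.min (f y) (g y))}.
Proof. exact: (@continuous_min R T f g x). Qed.

Lemma max_continuous_at (R : realType) (T : topologicalType) (f g : T -> R) x :
  {for x, continuous f} -> {for x, continuous g} ->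
  {for x, continuous (fun y => Num.max (f y) (g y))}.
Proof. exact: (@continuous_max R T f g x). Qed.

Lemma pair_continuous_at (T U V : topologicalType) (f : T -> U) (g : T -> V) x :
  {for x, continuous f} -> {for x, continuous g} ->
  {for x, continuous (fun y => (f y, g y))}.
Proof. by move=> cf cg; apply: cvg_pair; [exact: cf | exact: cg]. Qed.

Section Lifting.
Context {R : realType} {X Z : topologicalType} (h : X -> Z) (A : set Z).
Context (hX : hausdorff_space X) (hA : finite_covering_over h A).

(** The covering is used through local sections: [s] inverts [h] on the sheet [V], so a lift is
    continued by composing with [s]. Outside [U] the section takes an irrelevant default value. *)
Lemma evenly_covered z : A z -> exists U, [/\ open U, U z, U `<=` A &
  forall x, U (h x) -> exists V s,
    [/\ open V, V x, forall y, V y -> U (h y) /\ s (h y) = y,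
        forall u, U u -> V (s u) /\ h (s u) = u
      & forall u, U u -> {for u, continuous s}]].
Proof.
move=> /hA[U [[oU Uz UA] [d [V [tV VE oV bV hV]]]]].
exists U; split=> // x Ux.
have [a _ Vx] : (\bigcup_i V i) x by rewrite -VE.
have [/= funV injV surV] := bV a.
have ex u : exists y, U u -> V a y /\ h y = u.
  have [/surV[y Vy <-]|nU] := pselect (U u); last by exists x.
  by exists y.
have [s sP] := choice ex; exists (V a), s; split=> //.
- move=> y Vy; have Uy : U (h y) by exact: funV.
  split=> //; apply: injV; rewrite ?inE //; first by case: (sP _ Uy).
  by case: (sP _ Uy).
- move=> u Uu O Os; have [Vs hs] := sP u Uu.
  have VO : V a `&` O^° `<=` V a by move=> ? [].
  have := hV a _ (openI (oV a) (@open_interior _ O)) VO.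
  move=> oh; have : nbhs u (h @` (V a `&` O^°)).
    by apply: open_nbhs_nbhs; split=> //; exists (s u).
  apply: filterS => _ [y [Vy Oy] <-] /=.
  have Uy : U (h y) by exact: funV.
  have [Vsy hsy] := sP _ Uy.
  have -> : s (h y) = y by apply: injV; rewrite ?inE.
  exact: interior_subset Oy.
Qed.

Lemma lift_unique (T : topologicalType) (f g : T -> X) (t0 : T) :
  connected [set: T] -> continuous f -> continuous g ->
  (forall t, A (h (f t))) -> (forall t, h (f t) = h (g t)) -> f t0 = g t0 ->
  forall t, f t = g t.
Proof.
move=> cT cf cg Af fg fg0.
apply: (@connected_clopenT _ [set t | f t = g t]) => //; last by exists t0.
- rewrite openE => t /= ft.
  have [U [oU Uz UA sh]] := evenly_covered (Af t).
  have [V [s [oV Vx Vs _ _]]] := sh _ Uz.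
  have Vf : nbhs t (f @^-1` V) by apply: cf; exact: open_nbhs_nbhs.
  have Vg : nbhs t (g @^-1` V) by apply: cg; apply: open_nbhs_nbhs; rewrite -ft.
  apply: filterS (filterI Vf Vg) => u [/= /Vs[_ <-] /Vs[_ <-]].
  by rewrite fg.
- rewrite openE => t /= ft.
  have [U [V [[oU oV] Ux Vy UV]]] := hausdorff_sep hX ft.
  have Vf : nbhs t (f @^-1` U) by apply: cf; exact: open_nbhs_nbhs.
  have Vg : nbhs t (g @^-1` V) by apply: cg; exact: open_nbhs_nbhs.
  apply: filterS (filterI Vf Vg) => u [/= Uu Vu] fgu.
  by apply: (UV (f u)); rewrite // fgu.
Qed.

(* For fixed [s0], the set of all [t] up to which [H] lifts, over some        *)
(* neighbourhood [N] of [s0], is open and closed.                             *)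
Lemma lift_locally (T : topologicalType) (H : T * R -> Z) (g0 : T -> X) (s0 : T) :
  continuous H -> (forall u, A (H u)) -> continuous g0 ->
  (forall s t, t <= 0 -> H (s, t) = h (g0 s)) ->
  forall t, exists (N : set T) (G : T * R -> X),
    [/\ nbhs s0 N, forall s u, N s -> h (G (s, u)) = H (s, Num.min u t),
        forall s u, N s -> u <= 0 -> G (s, u) = g0 s
      & forall s u, N s -> {for (s, u), continuous G}].
Proof.
move=> cH AH cg0 Hg0; pose P t := exists (N : set T) (G : T * R -> X),
    [/\ nbhs s0 N, forall s u, N s -> h (G (s, u)) = H (s, Num.min u t),
        forall s u, N s -> u <= 0 -> G (s, u) = g0 s
      & forall s u, N s -> {for (s, u), continuous G}].
rewrite -/(forall t, P t).
have cfst : continuous (@fst T R) by exact: fst_continuous.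
have csnd : continuous (@snd T R) by exact: snd_continuous.
have P0 t : t <= 0 -> P t.
  move=> t0; exists setT, (fun u => g0 u.1); split=> //.
  - exact: filterT.
  - by move=> s u _; rewrite Hg0 // ge_min t0 orbT.
  - move=> s u _; apply: (continuous_compose cfst cg0).
(* Inside one evenly covered neighbourhood, liftability passes between any two bounds; this gives
   openness and closedness at once. *)
have step t0 : exists2 e : R, 0 < e &
    forall t t', `|t - t0| < e -> `|t' - t0| < e -> P t -> P t'.
  have [U [oU Uz UA sh]] := evenly_covered (AH (s0, t0)).
  have : nbhs (s0, t0) (H @^-1` U) by apply: cH; exact: open_nbhs_nbhs.
  move=> [[N1 B] /= [nN1 /nbhs_ballP[e /= e0 Be]] NB].
  have NU s t : N1 s -> `|t - t0| < e -> U (H (s, t)).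
    move=> Ns te; apply: (NB (s, t)); split=> //=; apply: Be.
    by rewrite /ball /= distrC.
  exists e => // t t' te t'e [N [G [nN hG G0 cG]]].
  have [t'0|t'0] := lerP t' 0; first exact: P0.
  have [tt'|tt'] := lerP t' t.
    exists N, (fun u => G (u.1, Num.min u.2 t')); split=> //=.
    - by move=> s u Ns; rewrite hG // -minA (min_idPl tt').
    - by move=> s u Ns u0; rewrite G0 // ge_min u0.
    - move=> s u Ns; apply: (@continuous_comp _ _ _ (fun u => (u.1, Num.min u.2 t')) G).
        apply: pair_continuous_at => /=; first exact: cfst.
        apply: min_continuous_at; first exact: csnd.
        exact: cvg_cst.
      exact: cG.
  have hx : h (G (s0, t)) = H (s0, t) by rewrite hG ?minxx //; exact: nbhs_singleton.
  have [V [s [oV Vx Vs sV cs]]] : exists V s,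
    [/\ open V, V (G (s0, t)), forall y, V y -> U (h y) /\ s (h y) = y,
        forall u, U u -> V (s u) /\ h (s u) = u
      & forall u, U u -> {for u, continuous s}].
    by apply: sh; rewrite hx; apply: NU => //; exact: nbhs_singleton.
  pose N' := N `&` N1 `&` [set r | V (G (r, t))].
  (* [w] confines the second coordinate to the interval from [t] to [t'], so [H] stays in [U] there;
     past [t] the old lift is continued by the section. *)
  pose w (u : T * R) := Num.max t (Num.min u.2 t').
  have wt u : `|w u - t0| < e.
    rewrite /w; move: te t'e; rewrite !ltr_norml => /andP[? ?] /andP[? ?].
    by rewrite /Num.max /Num.min; case: ifP; case: ifP => *; apply/andP; split; lra.
  have cw : continuous w.
    move=> u; apply: (@max_continuous_at R _ (fun=> t) (fun u => Num.min u.2 t')).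
      exact: cvg_cst.
    by apply: (@min_continuous_at R _ snd (fun=> t')); [exact: csnd | exact: cvg_cst].
  exists N', (fun u => if u.2 <= t then G (u.1, Num.min u.2 t) else s (H (u.1, w u))).
  split.
  - rewrite /N'; apply: filterI; first exact: filterI.
    have cGt : {for s0, continuous (fun r => G (r, t))}.
      apply: (@continuous_comp _ _ _ (fun r => (r, t)) G).
        by apply: pair_continuous_at; [exact: cvg_id | exact: cvg_cst].
      by apply: cG; exact: nbhs_singleton.
    by apply: cGt; exact: open_nbhs_nbhs.
  - move=> r u [[Nr N1r] Vr] /=; case: ifPn => [ut|]; last first.
      rewrite -ltNge => tu; have [_ ->] := sV _ (NU r (w (r, u)) N1r (wt _)).
      by rewrite /w /=; congr (H (_, _)); apply/max_idPr; rewrite le_min !ltW.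
    rewrite hG // (min_idPl ut) (min_idPl ut) (min_idPl _) //.
    exact: le_trans ut (ltW tt').
  - move=> r u [[Nr N1r] Vr] u0 /=; case: ifPn => [ut|].
      by rewrite G0 // ge_min u0.
    rewrite -ltNge => tu; rewrite /w /= (min_idPl _); last first.
      exact: le_trans u0 (ltW t'0).
    rewrite (max_idPr (ltW tu)).
    have : H (r, u) = H (r, t) by rewrite !Hg0 // ltW // (lt_le_trans tu).
    move=> ->; have <- : h (G (r, t)) = H (r, t) by rewrite hG ?minxx.
    rewrite (Vs _ Vr).2 G0 //; exact: le_trans (ltW tu) u0.
  - move=> r u [[Nr N1r] Vr]; apply: paste_at => /=.
    + exact: csnd.
    + apply: (@continuous_comp _ _ _ (fun u => (u.1, Num.min u.2 t)) G).
        apply: pair_continuous_at => /=; first exact: cfst.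
        apply: min_continuous_at; first exact: csnd.
        exact: cvg_cst.
      exact: cG.
    + apply: (@continuous_comp _ _ _ (fun u => H (u.1, w u)) s).
        apply: (@continuous_comp _ _ _ (fun u => (u.1, w u)) H).
          by apply: pair_continuous_at; [exact: cfst | exact: cw].
        exact: cH.
      exact: (cs _ (NU r _ N1r (wt _))).
    + move=> /= ->; rewrite minxx /w /= (min_idPl (ltW tt')) maxxx.
      have <- : h (G (r, t)) = H (r, t) by rewrite hG ?minxx.
      by rewrite (Vs _ Vr).2.
apply: (@connected_clopenT _ P); first exact: connected_real.
- rewrite openE => t Pt; have [e e0 se] := step t.
  apply/nbhs_ballP; exists e => //= t' tt'; apply: se Pt; rewrite ?subrr ?normr0 //.
  by rewrite distrC.
- rewrite openE => t Pt; have [e e0 se] := step t.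
  apply/nbhs_ballP; exists e => //= t' tt' Pt'; apply: Pt.
  by apply: se Pt'; rewrite ?subrr ?normr0 // distrC.
- by exists 0; exact: P0.
Qed.

(** Precomposition with this retraction turns data controlled only on [0, 1] into maps of the whole
    line with the same control. *)
Definition clamp (t : R) : R := Num.max 0 (Num.min t 1).

Lemma clamp_continuous : continuous clamp.
Proof.
move=> t; apply: (@max_continuous_at R R (fun=> 0) (fun t => Num.min t 1)).
  exact: cvg_cst.
by apply: (@min_continuous_at R R id (fun=> 1)); [exact: cvg_id | exact: cvg_cst].
Qed.

Lemma clamp_itv t : 0 <= clamp t <= 1.
Proof. by rewrite /clamp le_max lexx /= ge_max ler01 ge_min lexx orbT. Qed.

Lemma clamp_id t : 0 <= t <= 1 -> clamp t = t.
Proof. by move=> /andP[t0 t1]; rewrite /clamp (min_idPl t1) (max_idPr t0). Qed.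

Lemma clamp0 : clamp 0 = 0. Proof. by rewrite clamp_id // lexx ler01. Qed.
Lemma clamp1 : clamp 1 = 1. Proof. by rewrite clamp_id // lexx ler01. Qed.

Definition lifts_to (c : R -> Z) (x y : X) := exists l : R -> X,
  [/\ continuous l, l 0 = x, l 1 = y & forall t, 0 <= t <= 1 -> h (l t) = c t].

Lemma lift_agree (l l' : R -> X) : continuous l -> continuous l' ->
  (forall t, 0 <= t <= 1 -> A (h (l t))) ->
  (forall t, 0 <= t <= 1 -> h (l t) = h (l' t)) -> l 0 = l' 0 ->
  forall t, 0 <= t <= 1 -> l t = l' t.
Proof.
move=> cl cl' Al ll' l0 t t01.
have := @lift_unique R (l \o clamp) (l' \o clamp) 0 (@connected_real R).
move=> /(_ _ _ _ _ _ t); rewrite /= (clamp_id t01); apply.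
- exact: (continuous_compose clamp_continuous cl).
- exact: (continuous_compose clamp_continuous cl').
- by move=> u; apply: Al; exact: clamp_itv.
- by move=> u; apply: ll'; exact: clamp_itv.
- by rewrite clamp0.
Qed.

Lemma lifts_to_unique (c : R -> Z) x y y' : (forall t, A (c t)) ->
  lifts_to c x y -> lifts_to c x y' -> y = y'.
Proof.
move=> Ac [l [cl l0 <- hl]] [l' [cl' l'0 <- hl']].
apply: lift_agree; rewrite ?lexx ?ler01 //.
- by move=> t t01; rewrite hl.
- by move=> t t01; rewrite hl ?hl'.
- by rewrite l0.
Qed.

Lemma lifts_to_exists (c : R -> Z) x : continuous c -> (forall t, A (c t)) ->
  h x = c 0 -> exists y, lifts_to c x y.
Proof.
move=> cc Ac hx.
have [||||N [G [nN hG G0 cG]]] :=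
    @lift_locally R (fun u => c (clamp u.2)) (fun=> x) 0 _ _ _ _ 1.
- apply: (continuous_compose _ cc).
  exact: (continuous_compose (@snd_continuous _ _) clamp_continuous).
- by move=> u; exact: Ac.
- by move=> u; exact: cvg_cst.
- move=> s t t0 /=; rewrite hx; congr c; rewrite /clamp.
  by apply/max_idPl; rewrite ge_min t0.
have N0 : N 0 by exact: nbhs_singleton.
exists (G (0, 1)), (fun t => G (0, t)); split=> //.
- move=> t; apply: (@continuous_comp _ _ _ (fun t => (0, t)) G); last exact: cG.
  by apply: pair_continuous_at; [exact: cvg_cst | exact: cvg_id].
- by rewrite G0.
- by move=> t t01; rewrite hG //= (min_idPl _) ?clamp_id //; case/andP: t01.
Qed.

(** The end of the lift is locally constant in the homotopy parameter, since it moves continuously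
    within one sheet above the fixed point [c 1]. The parameters whose lift ends at [y] thus form a
    clopen set. *)
Lemma lifts_to_homotopic (c d : R -> Z) x y : h x = c 0 -> homotopic A c d ->
  lifts_to c x y -> lifts_to d x y.
Proof.
move=> hx [H [cH AH H01 Hs]] lc.
pose P s := lifts_to (fun t => H (s, t)) x y.
have cHs s : continuous (fun t => H (s, t)).
  apply: (@continuous_compose R _ Z (fun t => (s, t))) cH.
  by apply: pair_continuous => t; [exact: cvg_cst | exact: cvg_id].
have ext f g : (forall t, f t = g t) -> lifts_to f x y -> lifts_to g x y.
  by move=> fg; have -> : f = g by apply/funext.
suff P1 : P 1 by apply: ext P1 => t; case: (H01 t).
have hxH s : h x = H (s, 0) by rewrite (Hs s).1.
have loc s : \forall s' \near s, P s' <-> P s.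
  have [||||N [G [nN hG G0 cG]]] :=
      @lift_locally R (fun u => H (u.1, clamp u.2)) (fun=> x) s _ _ _ _ 1.
  - apply: (continuous_compose _ cH); apply: pair_continuous.
      exact: fst_continuous.
    exact: (continuous_compose (@snd_continuous _ _) clamp_continuous).
  - by move=> u; exact: AH.
  - by move=> u; exact: cvg_cst.
  - move=> r t t0 /=; rewrite (hxH r); congr (H (_, _)); rewrite /clamp.
    by apply/max_idPl; rewrite ge_min t0.
  have liftG r : N r -> lifts_to (fun t => H (r, t)) x (G (r, 1)).
    move=> Nr; exists (fun t => G (r, t)); split=> //.
    - move=> t; apply: (@continuous_comp _ _ _ (fun t => (r, t)) G); last exact: cG.
      by apply: pair_continuous_at; [exact: cvg_cst | exact: cvg_id].
    - by rewrite G0.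
    - by move=> t t01; rewrite hG //= (min_idPl _) ?clamp_id //; case/andP: t01.
  have Ns : N s by exact: nbhs_singleton.
  have hG1 r : N r -> h (G (r, 1)) = c 1.
    by move=> Nr; rewrite hG //= minxx clamp1 (Hs r).2.
  have Ac1 : A (h (G (s, 1))) by rewrite hG.
  have [U [oU Uz UA sh]] := evenly_covered Ac1.
  have [V [sg [oV Vx Vs _ _]]] := sh _ Uz.
  have nV : nbhs s [set r | V (G (r, 1))].
    have cGt : {for s, continuous (fun r => G (r, 1))}.
      apply: (@continuous_comp R (R * R)%type X (fun r => (r, 1)) G).
        by apply: pair_continuous_at; [exact: cvg_id | exact: cvg_cst].
      exact: cG.
    by apply: cGt; exact: open_nbhs_nbhs.
  apply: filterS (filterI nN nV) => r [Nr /= Vr].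
  have E : G (r, 1) = G (s, 1).
    by rewrite -(Vs _ Vr).2 -[RHS](Vs _ Vx).2 !hG1.
  split=> Pr.
    rewrite /P (lifts_to_unique _ Pr (liftG r Nr)) ?E; last by move=> t; exact: AH.
    exact: liftG.
  rewrite /P (lifts_to_unique _ Pr (liftG s Ns)) -?E; last by move=> t; exact: AH.
  exact: liftG.
apply: (@connected_clopenT _ P); first exact: connected_real.
- by rewrite openE => s Ps; apply: filterS (loc s) => r [_]; apply.
- by rewrite openE => s Ps; apply: filterS (loc s) => r [Pr _] /Pr.
- by exists 0; apply: ext lc => t; case: (H01 t).
Qed.

Lemma lifts_to_cat (c d : R -> Z) x y z :
  lifts_to c x y -> lifts_to d y z -> lifts_to (path_cat c d) x z.
Proof.
move=> [l [cl l0 l1 hl]] [k [ck k0 k1 hk]].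
have [||cq _ q0 q1] := @is_path_cat R X setT x y z l k; [by split | by split |].
exists (path_cat l k); split=> // t /andP[t0 t1]; rewrite /path_cat.
by case: leP => t2; [rewrite hl | rewrite hk] => //; apply/andP; split; lra.
Qed.

Lemma lifts_to_rev (c : R -> Z) x y : lifts_to c x y -> lifts_to (path_rev c) y x.
Proof.
move=> [l [cl l0 l1 hl]].
have [|cq _ q0 q1] := @is_path_rev R X setT x y l; first by split.
exists (path_rev l); split=> // t /andP[t0 t1].
by rewrite /path_rev hl //; apply/andP; split; lra.
Qed.

End Lifting.

(** * Complements of branch loci *)

(** If [F] were infinite, the sets containing all but finitely many of its points would form a
    proper filter; a cluster point in [F] could not be isolated. *)
Lemma compact_discrete_finite (T : topologicalType) (F : set T) : compact F ->
  (forall x, F x -> exists2 V, nbhs x V & forall y, V y -> F y -> y = x) ->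
  finite_set F.
Proof.
move=> cF disc; apply: contrapT => infF.
pose G : set_system T := [set A | finite_set (F `\` A)].
have FG : Filter G.
  split=> [|A B GA GB|A B AB GA].
  - by rewrite /G /= setDT.
  - by rewrite /G /= setDIr finite_setU.
  - by apply: sub_finite_set GA => x [Fx nBx]; split=> // /AB.
have PG : ProperFilter G.
  by split=> //; rewrite /G /= setD0.
have GF : G F by rewrite /G /= setDv.
have [x [Fx clx]] := cF G PG GF.
have [V Vx VF] := disc x Fx.
have [y [[Fy yx] Vy]] : (F `\` [set x]) `&` V !=set0.
  apply: clx => //; rewrite /G /=.
  apply: (@sub_finite_set _ _ [set x]) => [y [Fy nFy]|]; last exact: finite_set1.
  by apply: contrapT => yx; apply: nFy.
by apply: yx; exact: VF.
Qed.

(** * Subsets of codimension two do not disconnect *)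

Section Joined.
Context {R : realType} {X : topologicalType}.
Implicit Types (A B : set X) (x y z : X).

Definition joined A x y := exists c : R -> X, is_path A x y c.

Lemma joined_sym A x y : joined A x y -> joined A y x.
Proof. by move=> [c cP]; exists (path_rev c); exact: is_path_rev. Qed.

Lemma joined_trans A x y z : joined A x y -> joined A y z -> joined A x z.
Proof.
by move=> [c cP] [d dP]; exists (path_cat c d); exact: is_path_cat cP dP.
Qed.

Definition segment (p p' : R * R * R) (u : R) : R * R * R :=
  ((p.1.1 + u * (p'.1.1 - p.1.1), p.1.2 + u * (p'.1.2 - p.1.2)),
   p.2 + u * (p'.2 - p.2)).

Lemma segment_continuous p p' : continuous (segment p p').
Proof.
have aff (a b : R) : continuous (fun u : R => a + u * b).
  move=> u; apply: cvgD; first exact: cvg_cst.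
  by apply: cvgM; [exact: cvg_id | exact: cvg_cst].
apply: pair_continuous; last exact: aff.
by apply: pair_continuous; exact: aff.
Qed.

Lemma joined_segment A (f : R * R * R -> X) p p' :
  (forall u, 0 <= u <= 1 -> {for segment p p' u, continuous f}) ->
  (forall u, 0 <= u <= 1 -> A (f (segment p p' u))) -> joined A (f p) (f p').
Proof.
move=> cf Af; exists (fun t => f (segment p p' (clamp t))); split.
- move=> t; apply: (@continuous_comp R (R * R * R)%type X
    (fun t => segment p p' (clamp t)) f).
    exact: (continuous_compose (@clamp_continuous R) (@segment_continuous p p')).
  by apply: cf; exact: clamp_itv.
- by move=> t; apply: Af; exact: clamp_itv.
- congr f; rewrite clamp0 /segment !mul0r !addr0.
  by case: p {cf Af} => [[? ?] ?].
- congr f; rewrite clamp1 /segment !mul1r !(addrC _ (_ - _)) !subrK.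
  by case: p' {cf Af} => [[? ?] ?].
Qed.

Lemma ball3E (a p : R * R * R) (e : R) : ball a e p <->
  [/\ `|a.1.1 - p.1.1| < e, `|a.1.2 - p.1.2| < e & `|a.2 - p.2| < e].
Proof. by split=> [[[? ?] ?]|[? ? ?]]; [split|split=> //; split]. Qed.

Lemma ball_segment (a p p' : R * R * R) (e u : R) : 0 <= u <= 1 ->
  ball a e p -> ball a e p' -> ball a e (segment p p' u).
Proof.
have conv (c x y : R) : 0 <= u <= 1 -> `|c - x| < e -> `|c - y| < e ->
    `|c - (x + u * (y - x))| < e.
  rewrite !ltr_norml => /andP[u0 u1] /andP[h1 h2] /andP[h3 h4].
  have [xy|xy] := lerP x y.
      have v0 : 0 <= u * (y - x) by rewrite mulr_ge0 // subr_ge0.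
      have v1 : u * (y - x) <= y - x by rewrite ler_piMl // subr_ge0.
      by apply/andP; split; lra.
    have v0 : 0 <= u * (x - y) by rewrite mulr_ge0 // subr_ge0 ltW.
    have v1 : u * (x - y) <= x - y by rewrite ler_piMl // subr_ge0 ltW.
    by apply/andP; split; lra.
by move=> u01 /ball3E[? ? ?] /ball3E[? ? ?]; apply/ball3E; split; exact: conv.
Qed.

(* [B] does not disconnect [X] near [y]; weaker than path connectedness of    *)
(* [W `\` B], as paths may leave [W].                                         *)
Definition thin_at B y := forall O, nbhs y O -> exists W, [/\ nbhs y W, W `<=` O &
  exists w0, [/\ W w0, ~ B w0 & forall w, W w -> ~ B w -> joined (~` B) w0 w]].

(** In the chart [B] lies on the axis [p.1 = a.1], and broken lines can go round it. Openness of [f]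
    at [a] is what manifold charts, branched models and tubular neighbourhoods followed by a section
    have in common. *)
Lemma thin_chart B (f : R * R * R -> X) a D : nbhs a D ->
  (forall p, D p -> {for p, continuous f}) ->
  (forall N, nbhs a N -> N `<=` D -> nbhs (f a) (f @` N)) ->
  (forall p, D p -> B (f p) -> p.1 = a.1) -> thin_at B (f a).
Proof.
move=> nD cf fN fB O nO.
have /nbhs_ballP[d /= d0 dDO] : nbhs a (D `&` f @^-1` O).
  by apply: filterI => //; apply: (cf a (nbhs_singleton nD)).
have bD p : ball a d p -> D p by move=> /dDO[].
exists (f @` ball a d); split.
- by apply: fN; [exact: nbhsx_ballx | exact: bD].
- by move=> _ [p /dDO[_ Op] <-].
have [e e0 ed] : exists2 e : R, 0 < e & e < d by exists (d / 2); lra.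
have b0 : `|0 : R| < d by rewrite normr0.
have be : `|- e| < d by rewrite normrN gtr0_norm.
pose pt (x y t : R) : R * R * R := ((a.1.1 + x, a.1.2 + y), a.2 + t).
have bpt (x y t : R) :
    ball a d (pt x y t) <-> [/\ `|- x| < d, `|- y| < d & `|- t| < d].
  rewrite ball3E /pt /=.
  by rewrite !(_ : forall c z : R, c - (c + z) = - z) // => c z;
    rewrite opprD addrA subrr add0r.
have npt (x y t : R) :
    ball a d (pt x y t) -> x <> 0 \/ y <> 0 -> ~ B (f (pt x y t)).
  move=> /bD Dp xy Bp; have E := fB _ Dp Bp.
  have /= ax := congr1 fst E; have /= ay := congr1 snd E.
  by case: xy; apply; lra.
have jseg (x y t x' y' t' : R) : ball a d (pt x y t) -> ball a d (pt x' y' t') ->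
    (forall u, 0 <= u <= 1 -> [\/ x + u * (x' - x) <> 0, y + u * (y' - y) <> 0
       | u = 0 /\ ~ B (f (pt x y t))]) ->
    joined (~` B) (f (pt x y t)) (f (pt x' y' t')).
  move=> bp bp' ne; apply: joined_segment => u u01.
    by apply: cf; apply: bD; exact: ball_segment.
  have bs := ball_segment u01 bp bp'.
  have sE : segment (pt x y t) (pt x' y' t') u =
      pt (x + u * (x' - x)) (y + u * (y' - y)) (t + u * (t' - t)).
    by rewrite /segment /pt /=; congr (_, _, _); lra.
  case: (ne u u01) => [h|h|[-> nB]].
  - by rewrite sE; apply: npt; [rewrite -sE | left].
  - by rewrite sE; apply: npt; [rewrite -sE | right].
  - by rewrite /segment !mul0r !addr0.
have bp0 : ball a d (pt e 0 0) by apply/bpt; rewrite oppr0.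
exists (f (pt e 0 0)); split; first by exists (pt e 0 0).
  by apply: npt => //; left=> e00; move: e0; rewrite e00 ltxx.
move=> _ [p bp <-] nBp; apply: joined_sym.
have pE : p = pt (p.1.1 - a.1.1) (p.1.2 - a.1.2) (p.2 - a.2).
  by rewrite /pt !(addrC _ (_ - _)) !subrK; case: p {bp nBp} => [[? ?] ?].
move: bp nBp; rewrite pE.
move: (p.1.1 - a.1.1) (p.1.2 - a.1.2) (p.2 - a.2) => x y t bp nBp.
have [bx by_ bt] := (bpt _ _ _).1 bp.
have down : joined (~` B) (f (pt e 0 t)) (f (pt e 0 0)).
  apply: jseg => //; first by apply/bpt; split; rewrite ?oppr0.
  by move=> u u01; apply: Or31; lra.
(* Three routes: if [y] is nonzero, bring [x] to [e] first; from the axis, go straight to [(e, 0)],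
   only the start being on the axis and known to be off [B]; if only [x] is nonzero, go round
   through [(x, e)] and [(e, e)]. *)
have [y0|/eqP y0] := eqVneq y 0; last first.
  apply: (@joined_trans _ _ (f (pt e y t))).
    apply: jseg => //; first by apply/bpt.
    by move=> u u01; apply: Or32; lra.
  apply: joined_trans _ down.
  apply: jseg => //; [by apply/bpt | by apply/bpt; split; rewrite ?oppr0 |].
  by move=> u u01; apply: Or31; lra.
subst y; have [x0|/eqP x0] := eqVneq x 0.
  subst x; apply: joined_trans _ down; apply: jseg => //.
    by apply/bpt; split; rewrite ?oppr0.
  move=> u u01; have [->|/eqP u0] := eqVneq u 0; first exact: Or33.
  by apply: Or31; nra.
apply: (@joined_trans _ _ (f (pt x e t))).
  apply: jseg => //; first by apply/bpt.
  by move=> u u01; apply: Or31; lra.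
apply: (@joined_trans _ _ (f (pt e e t))).
  apply: jseg; [by apply/bpt | by apply/bpt |].
  by move=> u u01; apply: Or32; lra.
apply: joined_trans _ down.
apply: jseg; [by apply/bpt | by apply/bpt; split; rewrite ?oppr0 |].
by move=> u u01; apply: Or31; lra.
Qed.

Lemma thin_point B y O : thin_at B y -> nbhs y O -> exists2 w, O w & ~ B w.
Proof. by move=> tB /tB[W [_ WO [w [Ww nBw _]]]]; exists w => //; exact: WO. Qed.

(** The points near which everything off [B] can be joined to [x] form a clopen set: overlapping
    neighbourhoods always share a point off [B]. *)
Lemma thin_joined B x y : connected [set: X] -> (forall z, thin_at B z) ->
  ~ B x -> ~ B y -> joined (~` B) x y.
Proof.
move=> cX tB nBx nBy.
pose U z := exists2 W, nbhs z W & forall w, W w -> ~ B w -> joined (~` B) x w.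
suff : U y by move=> [W /nbhs_singleton Wy]; apply.
apply: (@connected_clopenT _ U) => //.
- rewrite openE => z [W nW Wj]; apply: filterS (nbhs_interior nW) => z' nW'.
  by exists W.
- rewrite openE => z nUz.
  have [W [nW _ [w0 [Ww0 nBw0 Wj]]]] := tB z _ filterT.
  apply: filterS (nbhs_interior nW) => z' nW' [W' nW'' W'j].
  have [w [Ww W'w] nBw] := thin_point (tB z') (filterI nW' nW'').
  apply: nUz; exists W => // v Wv nBv.
  apply: joined_trans (W'j w W'w nBw) _.
  exact: joined_trans (joined_sym (Wj w Ww nBw)) (Wj v Wv nBv).
- have [W [nW _ [w0 [Ww0 nBw0 Wj]]]] := tB x _ filterT.
  exists x, W => // w Ww nBw.
  have xW := Wj x (nbhs_singleton nW) nBx.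
  exact: joined_trans (joined_sym xW) (Wj w Ww nBw).
Qed.

End Joined.

(** * Knots, finite sublinks and the branching model *)

Section Knots.
Context {R : realType} {Z : topologicalType}.

Lemma knot_range_closed (k : R -> Z) : hausdorff_space Z -> knot k -> closed (range k).
Proof.
move=> hZ [ck kP]; apply: compact_closed => //.
have -> : range k = k @` `[0, 1].
  apply/seteqP; split=> [_ [t _ <-]|_ [t _ <-]]; last by exists t.
  exists (t - (Num.floor t)%:~R) => /=.
    have /andP[f0 f1] := floor_itv t.
    rewrite in_itv /=; apply/andP; split; first lra.
    by move: f1; rewrite intrD; lra.
  apply/kP; rewrite addrAC subrr sub0r rpredN; exact: intr_int.
apply: continuous_compact; last exact: segment_compact.
exact: continuous_subspaceT.
Qed.

Lemma knots_closed (K : nat -> R -> Z) (D : set nat) : hausdorff_space Z ->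
  tame_link K -> finite_set D -> closed (\bigcup_(i in D) range (K i)).
Proof.
move=> hZ [tK _] fD; apply: closed_bigcup => // i _.
by apply: knot_range_closed => //; case: (tK i).
Qed.

Lemma knot_index (K : nat -> R -> Z) i j z : tame_link K ->
  range (K i) z -> range (K j) z -> i = j.
Proof. by move=> [_ tI] zi zj; apply: tI => //; exists z. Qed.

Lemma sublinkS (K : nat -> R -> Z) m n : (m <= n)%N -> sublink K m `<=` sublink K n.
Proof. by move=> mn z [i /= im zi]; exists i => //=; exact: leq_trans mn. Qed.

Lemma complex_exp0 e : (0 < e)%N -> complex_exp (0 : R * R) e = 0.
Proof. by case: e => // e _; rewrite /= /complex_mul /= !mul0r subrr addr0. Qed.

(** The squared modulus is multiplicative. *)
Lemma complex_exp_eq0 (z : R * R) e : (0 < e)%N -> complex_exp z e = 0 -> z = 0.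
Proof.
have norm0 (x : R * R) : x.1 ^+ 2 + x.2 ^+ 2 = 0 -> x = 0.
  move=> /eqP; rewrite paddr_eq0 ?sqr_ge0 // !sqrf_eq0 => /andP[/eqP x1 /eqP x2].
  by case: x x1 x2 => /= ? ? -> ->.
move=> _; have [//|/eqP z0] := eqVneq z 0.
have nz : z.1 ^+ 2 + z.2 ^+ 2 != 0 by apply/eqP => /norm0.
suff ne : forall e, (complex_exp z e).1 ^+ 2 + (complex_exp z e).2 ^+ 2 != 0.
  by move=> ez; move: (ne e); rewrite ez /= expr0n /= addr0 eqxx.
elim=> [|n IH]; first by rewrite /= expr1n expr0n /= addr0 oner_eq0.
have -> : (complex_exp z n.+1).1 ^+ 2 + (complex_exp z n.+1).2 ^+ 2 =
  (z.1 ^+ 2 + z.2 ^+ 2) * ((complex_exp z n).1 ^+ 2 + (complex_exp z n).2 ^+ 2).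
  rewrite /complex_exp iterS -/(complex_exp z n) /complex_mul /=.
  move: (complex_exp z n) => w; ring.
by rewrite mulf_neq0.
Qed.

End Knots.

(** * Rigidity of maps between branched covers *)

Section BranchedCover.
Context {R : realType} {Z : topologicalType} (K : nat -> R -> Z).
Context (hZ : hausdorff_space Z) (tK : tame_link K).
Implicit Types X Y : topologicalType.

(* The bound [m] allows covers with distinct branch loci to be compared       *)
(* outside of the common sublink [sublink K m].                               *)
Definition branched_upto X (h : X -> Z) (m : nat) :=
  closed_3manifold R X /\
  exists2 n, (n <= m)%N & @branched_cover_along R X Z h (sublink K n).

Lemma branched_uptoW X (h : X -> Z) m n : (m <= n)%N ->
  branched_upto h m -> branched_upto h n.
Proof.
by move=> mn [mX [k km hk]]; split=> //; exists k => //; exact: leq_trans mn.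
Qed.

Lemma cov_branched X (h : X -> Z) : cov K h -> exists m, branched_upto h m.
Proof. by move=> [mX [n hn]]; exists n; split=> //; exists n. Qed.

Section OneCover.
Context {X : topologicalType} (h : X -> Z) (m : nat) (hm : branched_upto h m).

Lemma cover_hausdorff : hausdorff_space X. Proof. by case: hm => -[]. Qed.
Lemma cover_compact : compact [set: X]. Proof. by case: hm => -[]. Qed.
Lemma cover_connected : connected [set: X]. Proof. by case: hm => -[]. Qed.
Lemma cover_continuous : continuous h. Proof. by case: hm => _ [n _ []]. Qed.

Lemma cover_finite_covering : finite_covering_over h (~` sublink K m).
Proof.
have [_ [n nm [ch fc _]]] := hm; move=> x nx.
have nxn : (~` sublink K n) x by move=> /(sublinkS nm).
have [U [[oU Ux UA] [d [V [tV VE oV bV hV]]]]] := fc x nxn.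
have oS : open (~` sublink K m) by apply: closed_openC; exact: knots_closed.
pose S := ~` sublink K m.
have oS' : open (h @^-1` S) by move/continuousP : ch; exact.
exists (U `&` S); split.
  by split; [exact: openI | | by move=> ? []].
exists d, (fun i => V i `&` h @^-1` S); split.
- move=> i j _ _ [y [[Vi _] [Vj _]]]; apply: (tV i j) => //; by exists y.
- by rewrite preimage_setI VE setI_bigcupl.
- by move=> i; exact: openI.
- move=> i; have [f1 f2 f3] := bV i; split.
  + by move=> y [Vy Sy]; split=> //; exact: f1.
  + move=> y y'; rewrite !inE => -[Vy _] [Vy' _]; apply: f2; by rewrite inE.
  + by move=> u [/f3[y Vy <-] Su]; exists y.
- by move=> i W oW WV; apply: (hV i) => // y /WV[].
Qed.

(** A suitable chart exists at each kind of point: the local model over the branch locus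
    [sublink K n], a manifold chart off [sublink K m], and, over the remaining knots, a tubular
    neighbourhood carried to [X] by a local section. Each is shrunk to avoid the other knots. *)
Lemma thin_branch y : @thin_at R X (h @^-1` sublink K m) y.
Proof.
have [[hX cX conX neX mX] [n nm [ch fc br]]] := hm.
have preC (C : set Z) : closed C -> open (~` (h @^-1` C)).
  by move=> cC; apply: closed_openC; move/continuous_closedP : ch; exact.
have [yn|yn] := pselect (sublink K n (h y)).
  have [e [phi [psi [e0 [[cphi iphi ophi] [cpsi ipsi opsi]] <- Lpsi hphi]]]] := br y yn.
  pose C := \bigcup_(i in [set i | (n <= i < m)%N]) range (K i).
  have cC : closed C.
    apply: knots_closed => //; apply: (sub_finite_set _ (finite_II m)).
    by move=> i /= /andP[].
  apply: (@thin_chart _ _ _ phi (0, 0) (phi @^-1` (~` (h @^-1` C)))) => //.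
  + apply: cphi; apply: open_nbhs_nbhs; split; first exact: preC.
    move=> [i /= /andP[ni _] zi].
    have : (sublink K n) (h (phi (0, 0))).
      by rewrite hphi; apply/Lpsi; exact: complex_exp0.
    by move=> [j /= jn zj]; have := knot_index tK zi zj; lia.
  + by move=> p _; exact: cphi.
  + move=> N nN _; have := ophi _ (@open_interior _ N).
    move=> oN; rewrite nbhsE /=; exists (phi @` N°) => [|_ [p Np <-]].
      by split=> //; exists (0, 0).
    by exists p => //; exact: interior_subset.
  + move=> [z t] nCp [i /= im zi] /=.
    have [ni|ni] := leqP n i; first by case: nCp; exists i => //=; rewrite ni.
    apply: (@complex_exp_eq0 _ _ e) => //; apply/(Lpsi _ t).
    by rewrite -hphi; exists i.
have [ym|ym] := pselect (sublink K m (h y)); last first.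
  have [f [[cf jf of_] [a _ fa]]] := mX y; rewrite -fa.
  apply: (@thin_chart _ _ _ f a (f @^-1` (~` (h @^-1` sublink K m)))) => //.
  + apply: cf; apply: open_nbhs_nbhs; split; last by rewrite fa.
    by apply: preC; exact: knots_closed.
  + by move=> p _; exact: cf.
  + move=> N nN _; have := of_ _ (@open_interior _ N).
    move=> oN; rewrite nbhsE /=; exists (f @` N°) => [|_ [p Np <-]].
      by split=> //; exists a.
    by exists p => //; exact: interior_subset.
have [i /= im [t0 _ it0]] := ym.
have [U [oU Uy UA sh]] := evenly_covered fc yn.
have [V [s [oV Vy Vs sV cs]]] := sh y Uy.
have [[ki [E [cE oE injE E0]]] _] := (tK.1 i, tK.2).
pose C := \bigcup_(j in [set j | (j < m)%N /\ j <> i]) range (K j).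
have cC : closed C.
  apply: knots_closed => //; apply: (sub_finite_set _ (finite_II m)).
  by move=> j /= [].
have Et0 : E (0, t0) = h y by rewrite E0.
have -> : y = s (E (0, t0)) by rewrite Et0 (Vs _ Vy).2.
pose D := E @^-1` (U `&` ~` C).
have Ua : U (E (0, t0)) by rewrite Et0.
apply: (@thin_chart _ _ _ (s \o E) (0, t0) D).
- apply: cE; apply: filterI; first by apply: open_nbhs_nbhs.
  apply: open_nbhs_nbhs; split; first exact: closed_openC.
  move=> [j /= [_ ji] zj]; apply: ji; apply: (knot_index tK zj).
  by exists t0 => //; rewrite -E0.
- by move=> p [Up _]; apply: continuous_comp; [exact: cE | exact: cs].
- move=> N nN ND.
  have oEN := oE _ (@open_interior _ N).
  have oW : open (V `&` h @^-1` (E @` N°)).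
    by apply: openI => //; move/continuousP : ch; exact.
  rewrite nbhsE; exists (V `&` h @^-1` (E @` N°)).
    split=> //; split; first exact: (sV _ Ua).1.
    by exists (0, t0) => //; rewrite (sV _ Ua).2.
  move=> x [Vx [p Np Ep]]; exists p; first exact: interior_subset.
  by rewrite /= Ep (Vs _ Vx).2.
- move=> [z t] [Up nCp] /=; rewrite /preimage /= (sV _ Up).2 => -[j /= jm zj].
  have [ji|/eqP ji] := eqVneq j i; last by case: nCp; exists j.
  by move: zj; rewrite ji => -[t' _]; rewrite -E0 => /injE[-> ].
Qed.

Lemma generic_point (x : X) O : nbhs x O ->
  exists2 y, O y & ~ sublink K m (h y).
Proof. by move=> nO; have [w] := thin_point (@thin_branch x) nO; exists w. Qed.

Lemma generic_joined (x y : X) : ~ sublink K m (h x) -> ~ sublink K m (h y) ->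
  @joined R X (~` (h @^-1` sublink K m)) x y.
Proof. exact: (thin_joined cover_connected thin_branch). Qed.

(** Fibres are compact and discrete; at a ramified point this is because the power map has 0 as its
    only zero. *)
Lemma fibre_finite z : finite_set (h @^-1` [set z]).
Proof.
apply: compact_discrete_finite => [|x hx].
  apply: (subclosed_compact _ cover_compact) => //.
  move/continuous_closedP : cover_continuous; apply.
  by apply: accessible_closed_set1; exact: hausdorff_accessible.
have [_ [n _ [ch fc br]]] := hm.
have [xn|xn] := pselect (sublink K n (h x)); last first.
  have [U [oU Ux UA sh]] := evenly_covered fc xn.
  have [V [s [oV Vx Vs _ _]]] := sh x Ux.
  exists V; first exact: open_nbhs_nbhs.
  by move=> y Vy hy; rewrite -(Vs _ Vy).2 (hy : h y = z) -(hx : h x = z) (Vs _ Vx).2.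
have [e [phi [psi [e0 [[cphi iphi ophi] [cpsi ipsi opsi]] E Lpsi hphi]]]] := br x xn.
exists (range phi).
  apply: open_nbhs_nbhs; split; last by exists (0, 0).
  exact: ophi openT.
move=> _ [[w t] _ <-] hy; move: hx; rewrite -E /= -hy /= !hphi => /ipsi.
rewrite -[X in complex_exp X e]/(0 : R * R) complex_exp0 //.
by move=> -[/esym/(complex_exp_eq0 e0) -> <-].
Qed.

End OneCover.

Section TwoCovers.
Context {X Y : topologicalType} (hX : X -> Z) (hY : Y -> Z) (m : nat).
Context (Xm : branched_upto hX m) (Ym : branched_upto hY m).

(** Off the sublink, points are joined to [x] by paths avoiding it, along which lifts are unique.
    Such points are dense and [Y] is Hausdorff, so the equality extends to all of [X]. *)
Lemma rigid (f g : X -> Y) x : continuous f -> continuous g ->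
  (forall u, hY (f u) = hX u) -> (forall u, hY (g u) = hX u) ->
  ~ sublink K m (hX x) -> f x = g x -> forall y, f y = g y.
Proof.
move=> cf cg hf hg gx fgx.
have gen y : ~ sublink K m (hX y) -> f y = g y.
  move=> gy; have [c [cc Ac c0 <-]] := generic_joined Xm gx gy.
  have := @lift_unique _ _ _ _ (cover_hausdorff Ym) (cover_finite_covering Ym).
  move=> /(_ _ (f \o c) (g \o c) 0); apply=> //=.
  - exact: connected_real.
  - exact: (continuous_compose cc cf).
  - exact: (continuous_compose cc cg).
  - by move=> t; rewrite hf; exact: Ac.
  - by move=> t; rewrite hf hg.
  - by rewrite c0.
move=> y; apply: contrapT => fgy.
have [U [V [[oU oV] Ux Vy UV]]] := hausdorff_sep (cover_hausdorff Ym) fgy.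
have nU : nbhs y (f @^-1` U) by apply: cf; exact: open_nbhs_nbhs.
have nV : nbhs y (g @^-1` V) by apply: cg; exact: open_nbhs_nbhs.
have [w [/= Uw Vw] gw] := generic_point Xm (filterI nU nV).
by apply: (UV (f w)); rewrite // gen.
Qed.

Lemma lift_path_over (f : X -> Y) (c : R -> Y) x : continuous f ->
  (forall u, hY (f u) = hX u) -> continuous c ->
  (forall t, ~ sublink K m (hY (c t))) -> f x = c 0 ->
  exists l : R -> X,
    [/\ continuous l, l 0 = x & forall t, 0 <= t <= 1 -> f (l t) = c t].
Proof.
move=> cf hf cc gc fx.
have [||y [l [cl l0 l1 hl]]] :=
    @lifts_to_exists R _ _ _ _ (cover_finite_covering Xm) (hY \o c) x _ gc.
- exact: (continuous_compose cc (cover_continuous Ym)).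
- by rewrite /= -fx hf.
exists l; split=> //.
apply: (@lift_agree R _ _ _ _ (cover_hausdorff Ym)
  (cover_finite_covering Ym) (f \o l) c) => //=.
- exact: (continuous_compose cl cf).
- by move=> t t01; rewrite hf hl //; exact: gc.
- by move=> t t01; rewrite hf hl.
- by rewrite l0.
Qed.

(** A path off the sublink from a point of the image to [y] lifts through [f]. *)
Lemma generic_onto (f : X -> Y) (x0 : X) y : continuous f ->
  (forall u, hY (f u) = hX u) -> ~ sublink K m (hY y) -> exists x, f x = y.
Proof.
move=> cf hf gy; have [x _ gx] := generic_point Xm (@filterT _ (nbhs x0) _).
have gfx : ~ sublink K m (hY (f x)) by rewrite hf.
have [c [cc Ac c0 <-]] := generic_joined Ym gfx gy.
have [l [_ _ hl]] := lift_path_over cf hf cc Ac (esym c0).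
by exists (l 1); rewrite hl // lexx ler01.
Qed.

End TwoCovers.
End BranchedCover.

(** * The automorphism group of the pro-cover *)

Lemma ultra_finite_cover (I : Type) (T : choiceType) (F : set_system I)
    (D : set T) (A : T -> set I) : UltraFilter F -> finite_set D ->
  F (\bigcup_(y in D) A y) -> exists2 y, D y & F (A y).
Proof.
move=> UF fD FA; apply: contrapT => nA.
have [E DE] := finite_fsetP.1 fD.
have : F (\bigcap_(y in D) ~` A y).
  rewrite DE; apply: filter_bigI => y yE.
  have [FAy|//] := in_ultra_setVsetC (A y) UF.
  by case: nA; exists y => //; rewrite DE.
by move=> /(filterI FA)/filter_ex[l [[y Dy Ay] /(_ y Dy)]].
Qed.

Lemma cvg_to_initial (I : Type) (F : set_system I) (S : choiceType)
    (T : topologicalType) (v : S -> T) (u : I -> S) (s : S) : Filter F ->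
  (fun i => v (u i)) @ F --> v s -> u @ F --> (s : initial_topology v).
Proof.
move=> FF cv A; rewrite nbhsE => -[B [[V oV <-] Vs] BA].
have FV : F ((fun i => v (u i)) @^-1` V) by apply: cv; exact: open_nbhs_nbhs.
suff : F (u @^-1` A) by [].
by apply: filterS FV => i Vi; exact: BA.
Qed.

Lemma homeo_component (X : topologicalType) (A C : set X) (g g' : X -> X) x y :
  continuous g -> continuous g' -> cancel g g' -> cancel g' g ->
  (forall z, A (g z) <-> A z) -> C = connected_component A x ->
  C y -> C (g y) -> g @` C = C.
Proof.
move=> cg cg' gK g'K Ag -> Cy Cgy; apply/seteqP; split.
  rewrite [X in _ `<=` X](same_connected_component Cgy).
  apply: connected_component_max.
  - by exists y.
  - by move=> _ [z /connected_component_sub Az <-]; apply/Ag.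
  - apply: connected_continuous_connected; last exact: continuous_subspaceT.
    exact: component_connected.
have sub : g' @` connected_component A x `<=` connected_component A x.
  rewrite [X in _ `<=` X](same_connected_component Cy).
  apply: connected_component_max.
  - by exists (g y).
  - by move=> _ [z /connected_component_sub Az <-]; apply/Ag; rewrite g'K.
  - apply: connected_continuous_connected; last exact: continuous_subspaceT.
    exact: component_connected.
by move=> z Cz; exists (g' z) => //; apply: sub; exists z.
Qed.

Arguments Gal_at {M P} g i _.

Section ProCover.
Context {R : realType} {Z : topologicalType} (K : nat -> R -> Z).
Context (hZ : hausdorff_space Z) (tK : tame_link K).
Context (P : pro_cover Z) (PU : universal_pro_cover K P).

Local Notation X := (pc_space P).
Local Notation p := (pc_map P).
Local Notation t := (pc_trans P).

Lemma pc_branched i : exists m, branched_upto K (p i) m.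
Proof. by have [_ cP _ _ _] := PU; apply: cov_branched; case: (cP i). Qed.

Lemma pc_branched2 i j : exists m,
  branched_upto K (p i) m /\ branched_upto K (p j) m.
Proof.
have [[m im] [n jn]] := (pc_branched i, pc_branched j).
exists (maxn m n).
split; first exact: branched_uptoW (leq_maxl _ _) im.
exact: branched_uptoW (leq_maxr _ _) jn.
Qed.

Lemma pc_galois i : galois_cover (p i).
Proof. by have [_ cP _ _ _] := PU; case: (cP i). Qed.

Lemma pc_directed (i j : pc_index P) : exists k, pc_le i k /\ pc_le j k.
Proof. by have [[_ []]] := PU. Qed.

Lemma pc_lexx (i : pc_index P) : pc_le i i. Proof. by have [[]] := PU. Qed.

Lemma pc_trans_continuous i j (ij : pc_le i j) : continuous (t ij).
Proof. by have [_ _ tP _ _] := PU; case: (tP i j ij). Qed.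

Lemma pc_mapE i j (ij : pc_le i j) x : p i (t ij x) = p j x.
Proof. by have [_ _ tP _ _] := PU; case: (tP i j ij). Qed.

Lemma pc_transE i j k (ij : pc_le i j) (jk : pc_le j k) (ik : pc_le i k) x :
  t ij (t jk x) = t ik x.
Proof. by have [_ _ _ [_ tP] _] := PU; exact: tP. Qed.

Lemma pc_trans_id i (ii : pc_le i i) x : t ii x = x.
Proof. by have [_ _ _ [tP _] _] := PU; exact: tP. Qed.

Lemma pc_trans_irr i j (ij ij' : pc_le i j) x : t ij x = t ij' x.
Proof. by rewrite -(pc_transE ij (pc_lexx j) ij') pc_trans_id. Qed.

Lemma generic_exists (Y : topologicalType) (h : Y -> Z) m :
  branched_upto K h m -> exists y, ~ sublink K m (h y).
Proof.
move=> hm; have [[_ _ _ [y _] _] _] := hm.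
by have [x _ gx] := generic_point hZ tK hm (@filterT _ (nbhs y) _); exists x.
Qed.

Lemma deck_rigid (Y : topologicalType) (h : Y -> Z) m g g' y :
  branched_upto K h m -> deck h g -> deck h g' ->
  ~ sublink K m (h y) -> g y = g' y -> g = g'.
Proof.
move=> hm [cg hg _] [cg' hg' _] gy ggy; apply/funext.
exact: (rigid hZ tK hm hm cg cg' hg hg' gy ggy).
Qed.

(** The Galois property gives a candidate with the right value at one generic point, and rigidity
    makes it right everywhere. [deck_extend] follows the same pattern, with [generic_onto] supplying
    the target point upstairs. *)
Lemma deck_restrict i j (ij : pc_le i j) g : deck (p j) g ->
  exists2 g', deck (p i) g' & forall x, t ij (g x) = g' (t ij x).
Proof.
move=> [cg pg _]; have [m [im jm]] := pc_branched2 i j.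
have [x gx] := generic_exists jm.
have [|g' dg' gg'] := @pc_galois i (t ij x) (t ij (g x)).
  by rewrite !pc_mapE pg.
exists g' => //; have [cg' pg' _] := dg'.
apply: (rigid hZ tK jm im _ _ _ _ gx (esym gg')).
- exact: continuous_compose cg (@pc_trans_continuous _ _ ij).
- exact: continuous_compose (@pc_trans_continuous _ _ ij) cg'.
- by move=> u; rewrite pc_mapE pg.
- by move=> u; rewrite pg' pc_mapE.
Qed.

Lemma deck_extend i j (ij : pc_le i j) g' : deck (p i) g' ->
  exists2 g, deck (p j) g & forall x, t ij (g x) = g' (t ij x).
Proof.
move=> [cg' pg' _]; have [m [im jm]] := pc_branched2 i j.
have [x gx] := generic_exists jm.
have gy : ~ sublink K m (p i (g' (t ij x))) by rewrite pg' pc_mapE.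
have [y ty] := generic_onto hZ tK jm im x (@pc_trans_continuous _ _ ij)
  (pc_mapE ij) gy.
have [|g dg gxy] := @pc_galois j x y.
  by rewrite -[RHS](pc_mapE ij) ty pg' pc_mapE.
exists g => //; have [cg pg _] := dg.
apply: (rigid hZ tK jm im (x := x)) => //.
- exact: continuous_compose cg (@pc_trans_continuous _ _ ij).
- exact: continuous_compose (@pc_trans_continuous _ _ ij) cg'.
- by move=> u; rewrite pc_mapE pg.
- by move=> u; rewrite pg' pc_mapE.
- by rewrite gxy.
Qed.

Definition pc_filter : set_system (pc_index P) :=
  [set A | exists i, forall l, pc_le i l -> A l].

Lemma pc_filter_proper (i0 : pc_index P) : ProperFilter pc_filter.
Proof.
have [[_ [le_tr dir]] _ _ _ _] := PU.
apply: Build_ProperFilter_ex => [A [i iA]|].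
  by exists i; apply: iA; exact: pc_lexx.
split=> [|A B [i iA] [j jB]|A B AB [i iA]].
- by exists i0.
- have [k [ik jk]] := dir i j; exists k => l kl; split.
    by apply: iA; exact: le_tr ik kl.
  by apply: jB; exact: le_tr jk kl.
- by exists i => l /iA/AB.
Qed.

(* An ultrafilter finer than the order picks, at each level, one of the       *)
(* finitely many restrictions of the given deck transformations.              *)
Lemma Gal_limit k (S : forall l, set (X l -> X l)) :
  (forall l, pc_le k l -> S l !=set0) -> (forall l, S l `<=` deck (p l)) ->
  exists g : Gal P, forall i, exists l (il : pc_le i l) s,
    [/\ pc_le k l, S l s & forall x, t il (s x) = Gal_at g i (t il x)].
Proof.
move=> S0 Sdeck.
have [F [UF leF]] := ultraFilterLemma (pc_filter_proper k).
have exs l : exists s, pc_le k l -> S l s.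
  have [/S0[s Ss]|nkl] := pselect (pc_le k l); first by exists s.
  by exists id.
pose s l := sval (cid (exs l)).
have sP l : pc_le k l -> S l (s l) := svalP (cid (exs l)).
pose Q i g := [set l | pc_le k l /\
  exists il : pc_le i l, forall x, t il (s l x) = g (t il x)].
have exg i : exists g, deck (p i) g /\ F (Q i g).
  have [m im] := pc_branched i; have [x gx] := generic_exists im.
  (* A deck transformation of level [i] is recorded by its value at the generic point [x]; the
     values lie in a finite fibre, so the ultrafilter selects one. *)
  pose A y := [set l | pc_le k l /\ exists (il : pc_le i l) g,
    [/\ deck (p i) g, forall x, t il (s l x) = g (t il x) & g x = y]].
  have [||y yx FA] := @ultra_finite_cover _ _ F (p i @^-1` [set p i x]) A UF.
  - exact: (fibre_finite hZ im).
  - apply: leF; have [j [kj ij]] := pc_directed k i; exists j => l jl.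
    have [[_ [le_tr _]] _ _ _ _] := PU.
    have kl := le_tr _ _ _ kj jl; have il := le_tr _ _ _ ij jl.
    have [g dg gE] := deck_restrict il (Sdeck _ _ (sP l kl)).
    exists (g x); first by case: dg => _ pg _; rewrite /= pg.
    by split=> //; exists il, g.
  have [l0 [_ [_ [g [dg _ gxy]]]]] := filter_ex FA.
  exists g; split=> //; apply: filterS FA => l [kl [il [g' [dg' g'E g'x]]]].
  split=> //; exists il => z; rewrite g'E.
  by rewrite (deck_rigid im dg' dg gx) // g'x.
pose g i := sval (cid (exg i)).
have gd i : deck (p i) (g i) by case: (svalP (cid (exg i))).
have gQ i : F (Q i (g i)) by case: (svalP (cid (exg i))).
have gP : pro_deck g.
  split=> // i j ij.
  have [l [[_ [il ilE]] [_ [jl jlE]]]] := filter_ex (filterI (gQ i) (gQ j)).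
  have [m1 [im1 jm1]] := pc_branched2 i j; have [m2 lm2] := pc_branched l.
  pose m := maxn m1 m2.
  have im : branched_upto K (p i) m by exact: branched_uptoW (leq_maxl _ _) im1.
  have jm : branched_upto K (p j) m by exact: branched_uptoW (leq_maxl _ _) jm1.
  have lm : branched_upto K (p l) m by exact: branched_uptoW (leq_maxr _ _) lm2.
  have [x gx] := generic_exists lm.
  have [ci pi _] := gd i; have [cj pj _] := gd j.
  apply: (rigid hZ tK jm im (x := t jl x)).
  - exact: continuous_compose cj (@pc_trans_continuous _ _ ij).
  - exact: continuous_compose (@pc_trans_continuous _ _ ij) ci.
  - by move=> u; rewrite pc_mapE pj.
  - by move=> u; rewrite pi pc_mapE.
  - by rewrite pc_mapE.
  - by rewrite -jlE !(pc_transE ij jl il) ilE.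
exists (mk_Gal gP) => i; have [l [kl [il ilE]]] := filter_ex (gQ i).
by exists l, il, (s l); split=> //; exact: sP.
Qed.

Lemma Gal_extend k (g0 : X k -> X k) : deck (p k) g0 ->
  exists g : Gal P, Gal_at g k = g0.
Proof.
move=> dg0.
have [||g gS] := @Gal_limit k (fun l => [set s | deck (p l) s /\
    forall kl : pc_le k l, forall x, t kl (s x) = g0 (t kl x)]).
- move=> l kl; have [s ds sE] := deck_extend kl dg0; exists s; split=> // kl' x.
  by rewrite !(pc_trans_irr kl' kl).
- by move=> l s [].
exists g; have [l [kl [s [_ [ds sE] sg]]]] := gS k.
have [m [km lm]] := pc_branched2 k l; have [x gx] := generic_exists lm.
apply: (deck_rigid km (proj1 (GalP g) k) dg0 (y := t kl x)).
  by rewrite pc_mapE.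
by rewrite -sE sg.
Qed.

(** A lift of [g0] may carry [C] to another component with the same image; a deck transformation [a]
    brings a point back into [C]. Since [C] is unramified at level [i], [a] acts trivially there and
    the correction still lifts [g0]. *)
Lemma deck_stab i j (ij : pc_le i j) m (C : set (X j)) g0 :
  branched_upto K (p i) m -> (forall x, C x -> ~ sublink K m (p j x)) ->
  knot_components K (p j) C -> deck (p i) g0 -> g0 @` (t ij @` C) = t ij @` C ->
  exists2 g, deck (p j) g /\ g @` C = C & forall x, t ij (g x) = g0 (t ij x).
Proof.
move=> im gC [n [x [xn CE]]] dg0 g0C.
have [g dg gE] := deck_extend ij dg0; have [cg pg _] := dg.
have Cx : C x by rewrite CE; exact: connected_component_refl.
have [y Cy ty] : (t ij @` C) (g0 (t ij x)).
  by rewrite -g0C; exists (t ij x) => //; exists x.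
have [|a da ay] := @pc_galois j (g x) y.
  by rewrite pg -(pc_mapE ij y) ty -gE pc_mapE pg.
have [b db bE] := deck_restrict ij da.
(* [b] fixes an unramified point. *)
have b1 : b = id.
  have gy : ~ sublink K m (p i (t ij y)) by rewrite pc_mapE; exact: gC.
  apply: (deck_rigid im db (proj1 (GalP (1%g : Gal P)) i) gy).
  by rewrite [RHS]/= {1}ty -gE -bE ay.
have [ca pa [a' [ca' aK a'K]]] := da; have [_ _ [g' [cg' gK g'K]]] := dg.
have pag z : p j (a (g z)) = p j z by rewrite pa pg.
exists (a \o g); last by move=> z /=; rewrite bE b1 gE.
split.
  split=> //; first exact: continuous_compose cg ca.
  exists (g' \o a'); split; first exact: continuous_compose ca' cg'.
    exact: can_comp aK gK.
  exact: can_comp g'K a'K.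
apply: (homeo_component (A := p j @^-1` range (K n)) (g' := g' \o a')
  (x := x) (y := x)) => //.
- exact: continuous_compose cg ca.
- exact: continuous_compose ca' cg'.
- by move=> z /=; rewrite aK gK.
- by move=> z /=; rewrite g'K a'K.
- by move=> z; rewrite /preimage /= pag.
- by rewrite /= ay.
Qed.

(** At an unramified component, the decomposition group of the pro-cover surjects onto that of level
    [k]: the lifts from [deck_stab] are assembled by [Gal_limit]. *)
Lemma Gal_stab_extend k m (Cbar : forall i, set (X i)) g0 :
  branched_upto K (p k) m ->
  (forall i, knot_components K (p i) (Cbar i)) ->
  (forall i j (ij : pc_le i j), t ij @` Cbar j = Cbar i) ->
  (forall x, Cbar k x -> ~ sublink K m (p k x)) ->
  deck (p k) g0 -> g0 @` Cbar k = Cbar k ->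
  exists g : Gal P, Gal_at g k = g0 /\ forall i, Gal_at g i @` Cbar i = Cbar i.
Proof.
move=> km Cknot Ct gC dg0 g0C.
have [||g gS] := @Gal_limit k (fun l => [set s | [/\ deck (p l) s,
    s @` Cbar l = Cbar l &
    forall kl : pc_le k l, forall x, t kl (s x) = g0 (t kl x)]]).
- move=> l kl.
  have [||s [ds sC] sE] := @deck_stab k l kl m (Cbar l) g0 km _ (Cknot l) dg0.
  + move=> x Cx; rewrite -(pc_mapE kl); apply: gC; rewrite -(Ct _ _ kl).
    by exists x.
  + by rewrite Ct.
  exists s; split=> // kl' x.
  by rewrite !(pc_trans_irr kl' kl).
- by move=> l s [].
exists g; split.
  have [l [kl [s [_ [ds _ sE] sg]]]] := gS k.
  have [n [kn ln]] := pc_branched2 k l; have [x gx] := generic_exists ln.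
  apply: (deck_rigid kn (proj1 (GalP g) k) dg0 (y := t kl x)).
    by rewrite pc_mapE.
  by rewrite -sE sg.
move=> i; have [l [il [s [_ [ds sC _] sg]]]] := gS i.
rewrite -(Ct _ _ il) -{2}sC !image_comp; apply: eq_imagel => x _ /=.
by rewrite sg.
Qed.

(* Otherwise a net of elements, trivial at larger and larger levels, would    *)
(* converge to 1 with values of [f] different from [f 1].                     *)
Lemma Gal_level (H : subgroup (Gal P)) (D : choiceType)
    (f : subgroup_type H -> discrete_topology D) (i0 : pc_index P) :
  continuous f -> exists2 k, pc_le i0 k &
    forall g : subgroup_type H, Gal_at (val g) k = id -> f g = f 1%g.
Proof.
move=> cf; apply: contrapT => nk.
have exu k : exists g : subgroup_type H,
    pc_le i0 k -> Gal_at (val g) k = id /\ f g <> f 1%g.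
  have [ik|nik] := pselect (pc_le i0 k); last by exists 1%g.
  apply: contrapT => nu; apply: nk; exists k => // g gk.
  by apply: contrapT => fg; apply: nu; exists g.
have [u uP] := choice exu.
have FF := pc_filter_proper i0.
have cu : u @ pc_filter --> (1%g : subgroup_type H).
  apply: cvg_to_initial; apply: cvg_to_initial; apply/cvg_sup => i.
  apply: cvg_to_initial => O /principal_filterP O1.
  have [j [i0j ij]] := pc_directed i0 i; exists j => l jl; rewrite /preimage /=.
  have [[_ [le_tr _]] _ _ _ _] := PU.
  have [i0l il] := (le_tr _ _ _ i0j jl, le_tr _ _ _ ij jl).
  suff vE : set_val (set_val (u l)) i = id by rewrite vE; exact: O1.
  have [m [im lm]] := pc_branched2 i l; have [x gx] := generic_exists lm.
  apply: (deck_rigid im (proj1 (GalP (val (u l))) i)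
    (proj1 (GalP (1%g : Gal P)) i) (y := t il x)).
    by rewrite pc_mapE.
  have [_ tu] := GalP (val (u l)); rewrite -[LHS]tu.
  by have [E _] := uP l i0l; rewrite [X in t il (X x)]E.
have /discrete_continuousP/(_ 1%g) := cf => /cu [k kP].
have [l [i0l kl]] := pc_directed i0 k.
by have [_] := uP l i0l; apply; exact: kP.
Qed.

End ProCover.

(** * Preimages of the link *)

Lemma initial_hausdorff (S : choiceType) (T : topologicalType) (v : S -> T) :
  injective v -> hausdorff_space T -> hausdorff_space (initial_topology v).
Proof.
move=> iv hT; rewrite open_hausdorff => x y /eqP xy.
have [U [V [[oU oV] Ux Vy UV]]] : exists U V, [/\ open U /\ open V, U (v x),
    V (v y) & forall z, U z -> V z -> False].
  by apply: hausdorff_sep => // /iv.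
exists (v @^-1` U, v @^-1` V); first by split; rewrite inE.
split=> /=; [by exists U | by exists V |].
by apply/eqP/seteqP; split=> // z [/= /UV].
Qed.

Lemma sphere3_hausdorff (R : realType) : hausdorff_space (sphere3 R).
Proof. apply: initial_hausdorff; [exact: val_inj | exact: norm_hausdorff]. Qed.

Lemma finite_nat_bound (A : set nat) : finite_set A ->
  exists n, forall i, A i -> (i < n)%N.
Proof.
move=> /finite_seqP[s ->]; exists (\max_(i <- s) i).+1 => i /= si.
by rewrite ltnS; exact: (@leq_bigmax_seq nat s xpredT id i si isT).
Qed.

(** Were [B] false from some index on, the counts would be bounded and the averages would tend to
    0. *)
Lemma positive_density_often (R : realType) (n : nat) (B : nat -> bool) (l : R) :
  0 < l ->
  (fun nu : nat => (\sum_(n <= j < nu) B j)%N%:R / nu%:R : R) @ \oo --> l ->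
  forall N, exists2 j, (n <= j)%N && (N <= j)%N & B j.
Proof.
move=> l0 Bl N; apply: contrapT => nB.
have nBj j : (n <= j)%N -> (N <= j)%N -> B j = false.
  by move=> nj Nj; apply/negP => Bj; apply: nB; exists j; rewrite ?nj.
have bound nu : (\sum_(n <= j < nu) B j <= N)%N.
  have le1 : (\sum_(n <= j < nu) B j <= \sum_(n <= j < nu | (j < N)%N) 1)%N.
    rewrite big_mkcond [leqRHS]big_mkcond /= !big_nat.
    apply: leq_sum => j /andP[nj _].
    by case: ltnP => jN; [case: (B j) | rewrite nBj].
  apply: leq_trans le1 _; rewrite sum1_count.
  apply: (@leq_trans (size (iota 0 N))); last by rewrite size_iota.
  rewrite -size_filter; apply: uniq_leq_size; first exact/filter_uniq/iota_uniq.
  by move=> j; rewrite mem_filter mem_iota /= add0n => /andP[->].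
have : (fun nu : nat => (\sum_(n <= j < nu) B j)%N%:R / nu%:R : R) @ \oo --> (0 : R).
  rewrite -cvg_shiftS /=.
  apply: (@squeeze_cvgr _ _ _ _ (fun=> 0) (fun nu => N%:R * harmonic nu)).
  - apply: nearW => nu; rewrite divr_ge0 ?ler0n //=.
    by rewrite ler_pM2r ?invr_gt0 ?ltr0Sn // ler_nat.
  - exact: cvg_cst.
  - rewrite -(mulr0 (N%:R : R)); apply: cvgM; first exact: cvg_cst.
    exact: cvg_harmonic.
move=> /(cvg_unique (@Rhausdorff R) Bl) l00.
by move: l0; rewrite l00 ltxx.
Qed.

Section PreimageLink.
Context {R : realType} {Z M : topologicalType} (L : nat -> R -> Z) (h : M -> Z).
Context (hZ : hausdorff_space Z) (tL : tame_link L).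
Context (K' : nat -> R -> M) (i f : nat -> nat).
Context (bijK : set_bij setT (knot_components L h) (fun j => range (K' j))).
Context (covK : forall j, covers_knot h (L (i j)) (K' j) (f j)).

Lemma preimage_knotE j t : h (K' j t) = L (i j) ((f j)%:R * t).
Proof. by have [_ _] := covK j. Qed.

Lemma preimage_knot_range j w : range (K' j) w -> range (L (i j)) (h w).
Proof. by move=> [t _ <-]; rewrite preimage_knotE; exists ((f j)%:R * t). Qed.

Lemma preimage_knot_component j w : range (K' j) w ->
  range (K' j) = connected_component (h @^-1` range (L (i j))) w.
Proof.
move=> jw; have [fK _ _] := bijK.
have [a [x [ax E]]] := fK j I; have := jw; rewrite E => cw.
have aw : range (L a) (h w) := connected_component_sub cw.
rewrite -(knot_index tL aw (preimage_knot_range jw)).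
exact: same_connected_component.
Qed.

Lemma preimage_knot_exists a w : range (L a) (h w) ->
  exists2 j, i j = a & range (K' j) w.
Proof.
move=> aw; have [_ _ sK] := bijK.
have [|j _ jE] := sK (connected_component (h @^-1` range (L a)) w).
  by exists a, w.
have jw : range (K' j) w by rewrite jE; exact: connected_component_refl.
by exists j => //; exact: (knot_index tL (preimage_knot_range jw) aw).
Qed.

(** The starting points [K' j 0] are distinct and lie in the finite fibres over the points [L a 0]
    with [a < m]. *)
Lemma preimage_knots_over m n : branched_upto L h n ->
  exists N, forall j, (i j < m)%N -> (j < N)%N.
Proof.
move=> hn; pose phi j := K' j 0.
have jphi j : range (K' j) (phi j) by exists 0.
have iphi : injective phi.
  move=> j j' jj'; have [_ injK _] := bijK; apply: injK; rewrite ?inE //.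
  have j'w : range (K' j') (phi j) by rewrite jj'.
  rewrite (preimage_knot_component (jphi j)) (preimage_knot_component j'w).
  by rewrite (knot_index tL (preimage_knot_range (jphi j))
    (preimage_knot_range j'w)).
have fin : finite_set (phi @^-1` \bigcup_(a in `I_m) (h @^-1` [set L a 0])).
  apply: finite_preimage; first by move=> j j' _ _; exact: iphi.
  apply: bigcup_finite => [|a _]; first exact: finite_II.
  exact: (fibre_finite hZ hn).
have [N NP] := finite_nat_bound fin; exists N => j ij; apply: NP.
by exists (i j) => //=; rewrite preimage_knotE mulr0.
Qed.

End PreimageLink.

(** * Monodromy and Frobenius elements *)

Section Monodromy.
Context {R : realType} {Z M : topologicalType} (L : nat -> R -> Z) (h : M -> Z).
Context (hZ : hausdorff_space Z) (tL : tame_link L).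
Context (P : pro_cover Z) (PU : universal_pro_cover L P).
Context (i0 : pc_index P) (q : pc_space P i0 -> M) (q_cont : continuous q).
Context (q_over : forall x, h (q x) = pc_map P i0 x).
Context (k : pc_index P) (ik : pc_le i0 k) (m : nat).
Context (hm : branched_upto L h m) (i0m : branched_upto L (pc_map P i0) m).
Context (km : branched_upto L (pc_map P k) m).

Local Notation X := (pc_space P k).
Local Notation pk := (pc_map P k).
Local Notation H := (subgroup_type (Gal_over q)).

Definition pc_proj (x : X) : M := q (pc_trans P ik x).
Local Notation r := pc_proj.

Definition H_at (g : H) : X -> X := Gal_at (val g) k.

Lemma pc_proj_continuous : continuous r.
Proof. exact: continuous_compose (pc_trans_continuous PU (ij := ik)) q_cont. Qed.

Lemma pc_projE x : h (r x) = pk x.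
Proof. by rewrite /pc_proj q_over (pc_mapE PU). Qed.

Lemma H_at_deck g : deck pk (H_at g).
Proof. exact: (proj1 (GalP (val g)) k). Qed.

Lemma H_at_continuous g : continuous (H_at g).
Proof. by have [] := H_at_deck g. Qed.

Lemma H_at_map g x : pk (H_at g x) = pk x.
Proof. by have [_ ->] := H_at_deck g. Qed.

Lemma H_atM g g' x : H_at (g * g')%g x = H_at g (H_at g' x).
Proof. by []. Qed.

Lemma H_at1 x : H_at 1%g x = x.
Proof. by []. Qed.

Lemma H_at_proj g x : r (H_at g x) = r x.
Proof.
have [_ tg] := GalP (val g); rewrite /pc_proj [pc_trans P ik _]tg.
by have := set_mem (valP g); exact.
Qed.

(** By rigidity, acting over [M] can be tested at a single generic point. *)
Lemma over_of_deck (g : Gal P) x : ~ sublink L m (pk x) ->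
  r (Gal_at g k x) = r x -> over_set q g.
Proof.
move=> gx rg y; have [dg tg] := GalP g; have [cg pg _] := dg i0.
apply: (rigid hZ tL i0m hm (f := q \o Gal_at g i0) (x := pc_trans P ik x)) => //.
- exact: continuous_compose cg q_cont.
- by move=> u; rewrite /= q_over pg.
- by rewrite (pc_mapE PU).
- by rewrite /= -[X in q X]tg.
Qed.

Lemma H_transitive x y : ~ sublink L m (pk x) -> r x = r y ->
  exists g : H, H_at g x = y.
Proof.
move=> gx rxy; have [|g0 dg0 g0x] := pc_galois PU (i := k) (x := x) (y := y).
  by rewrite -!pc_projE rxy.
have [g gk] := Gal_extend hZ tL PU dg0.
have Hg : over_set q g.
  by apply: (over_of_deck gx); rewrite gk g0x.
exists (exist (fun g => g \in subgroup_set (Gal_over q)) g (mem_set Hg)).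
by rewrite /H_at /= gk.
Qed.

Lemma lifts_to_translate (c : R -> Z) x y (g : H) : lifts_to pk c x y ->
  lifts_to pk c (H_at g x) (H_at g y).
Proof.
move=> [l [cl l0 l1 hl]]; exists (H_at g \o l); split => /=.
- exact: continuous_compose cl (@H_at_continuous g).
- by rewrite l0.
- by rewrite l1.
- by move=> t t01; rewrite H_at_map hl.
Qed.

Lemma lift_proj (c : R -> M) (l : R -> X) : continuous c -> continuous l ->
  (forall t, 0 <= t <= 1 -> ~ sublink L m (h (c t))) ->
  (forall t, 0 <= t <= 1 -> pk (l t) = h (c t)) -> r (l 0) = c 0 ->
  forall t, 0 <= t <= 1 -> r (l t) = c t.
Proof.
move=> cc cl gc hl l0.
apply: (@lift_agree R _ _ _ _ (cover_hausdorff hm)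
  (cover_finite_covering hZ tL hm) (r \o l) c) => //=.
- exact: continuous_compose cl pc_proj_continuous.
- by move=> t t01; rewrite pc_projE hl //; exact: gc.
- by move=> t t01; rewrite pc_projE hl.
Qed.

Context (p : nat) (phi : H -> 'F_p).
Context (phiM : {morph phi : x y / (x * y)%g >-> x + y}).
Context (phi_k : forall g, H_at g = id -> phi g = phi 1%g).

Lemma phi1 : phi 1%g = 0.
Proof. by apply: (@addrI _ (phi 1%g)); rewrite -phiM mulg1 addr0. Qed.

Lemma phi_eq g g' x : ~ sublink L m (pk x) -> H_at g x = H_at g' x ->
  phi g = phi g'.
Proof.
move=> gx gg'.
have E : H_at g = H_at g'.
  exact: (deck_rigid hZ tL km (H_at_deck g) (H_at_deck g') gx).
have e : phi (g^-1 * g')%g = 0.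
  rewrite phi_k ?phi1 //; apply/funext => z.
  by rewrite H_atM -E -H_atM mulVg.
by have := phiM g (g^-1 * g')%g; rewrite mulKVg e addr0.
Qed.

Lemma phi_onto (v : 'F_p) : prime p -> (exists g, phi g <> 0) -> exists g, phi g = v.
Proof.
move=> pp [g /eqP g0].
have phiX n : phi (g ^+ n)%g = phi g *+ n.
  elim: n => [|n IH]; first by rewrite expg0 phi1.
  by rewrite expgS phiM IH mulrS.
exists (g ^+ (v / phi g)%R)%g.
by rewrite phiX -mulr_natr natr_Zp mulrCA divff ?mulr1.
Qed.

Context (K' : nat -> R -> M) (i f : nat -> nat).
Context (bijK : set_bij setT (knot_components L h) (fun j => range (K' j))).
Context (covK : forall j, covers_knot h (L (i j)) (K' j) (f j)).
(** Off the first [n] knots of the preimage, [h] avoids the first [m] knots of the base, so loops in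
    the complement lift to [X]. Conversely, points over the complement of the first [m'] knots avoid
    these [n] knots; this is why [x0] is chosen there. *)
Context (n : nat) (nP : forall j, (i j < m)%N -> (j < n)%N).
Context (m' : nat) (mm' : (m <= m')%N) (m'P : forall j, (j < n)%N -> (i j < m')%N).
Context (x0 : X) (gx0 : ~ sublink L m' (pk x0)).

Local Notation A := (~` sublink K' n).

Lemma sublink_above x : sublink K' n x -> sublink L m' (h x).
Proof.
move=> [j /= jn jx]; exists (i j); first exact: m'P.
exact: preimage_knot_range covK _ _ jx.
Qed.

Lemma sublink_below x : A x -> ~ sublink L m (h x).
Proof.
move=> Ax [a /= am ax]; have [j ija jx] := preimage_knot_exists tL bijK covK ax.
by apply: Ax; exists j => //=; apply: nP; rewrite ija.
Qed.

Lemma base_generic : ~ sublink L m (pk x0).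
Proof. by move=> /(sublinkS mm'). Qed.

Lemma base_subproof : r x0 \in A.
Proof. by apply/mem_set => /sublink_above; rewrite pc_projE. Qed.

Definition base : A := exist (fun x => x \in A) (r x0) base_subproof.

Local Notation Apath := (is_path A (r x0) (r x0)).

Definition monodromy (c : R -> M) (v : 'F_p) :=
  exists g : H, lifts_to pk (h \o c) x0 (H_at g x0) /\ phi g = v.

Lemma h_path_continuous (c : R -> M) : continuous c -> continuous (h \o c).
Proof. by move=> cc; exact: continuous_compose cc (cover_continuous hm). Qed.

Lemma monodromy_exists c : Apath c -> exists v, monodromy c v.
Proof.
move=> [cc Ac c0 c1].
have gc t : ~ sublink L m (h (c t)) by exact: sublink_below.
have [||y ly] := lifts_to_exists (cover_finite_covering hZ tL km)
  (c := h \o c) (x := x0) _ gc.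
- exact: h_path_continuous.
- by rewrite /= c0 pc_projE.
have [l [cl l0 l1 hl]] := ly.
have ry : r x0 = r y.
  rewrite -l1 (lift_proj cc cl) ?c1 ?l0 ?c0 ?lexx ?ler01 //.
have [g gy] := H_transitive base_generic ry.
by exists (phi g), g; rewrite gy.
Qed.

Lemma monodromy_unique c v w : (forall t, A (c t)) ->
  monodromy c v -> monodromy c w -> v = w.
Proof.
move=> Ac [g [lg <-]] [g' [lg' <-]]; apply: (phi_eq base_generic).
apply: (lifts_to_unique (cover_hausdorff km) (cover_finite_covering hZ tL km)
  _ lg lg').
by move=> t; exact: sublink_below.
Qed.

Lemma monodromy_homotopic c d v : Apath c -> homotopic A c d ->
  monodromy c v -> monodromy d v.
Proof.
move=> [_ _ c0 _] [G [cG AG G01 Gs]] [g [lg gv]]; exists g; split=> //.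
apply: (lifts_to_homotopic (cover_hausdorff km) (cover_finite_covering hZ tL km)
  _ _ lg); first by rewrite /= c0 pc_projE.
exists (h \o G); split=> [|u|t|s] /=.
- exact: continuous_compose cG (cover_continuous hm).
- exact: sublink_below.
- by have [-> ->] := G01 t.
- by have [-> ->] := Gs s.
Qed.

Lemma comp_path_cat (c d : R -> M) : h \o path_cat c d = path_cat (h \o c) (h \o d).
Proof. by apply/funext => t; rewrite /path_cat /=; case: ifP. Qed.

(** The lift of [d] is translated by [g] to start where that of [c] ends; hence the order [g * g'],
    which makes [rho] a homomorphism. *)
Lemma monodromy_cat c d v w : monodromy c v -> monodromy d w ->
  monodromy (path_cat c d) (v + w).
Proof.
move=> [g [lg <-]] [g' [lg' <-]]; exists (g * g')%g; split; last exact: phiM.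
rewrite comp_path_cat H_atM; apply: lifts_to_cat lg _.
exact: lifts_to_translate.
Qed.

(** The complement of the preimage of the first [m'] knots in [X] is path connected; a path from
    [x0] to its translate projects to a loop. *)
Lemma monodromy_onto g : exists2 c, Apath c & monodromy c (phi g).
Proof.
have gg : ~ sublink L m' (pk (H_at g x0)) by rewrite H_at_map.
have km' : branched_upto L pk m' by exact: branched_uptoW mm' km.
have [l [cl Al l0 l1]] := generic_joined hZ tL km' gx0 gg.
exists (r \o l).
  split=> /=.
  - exact: continuous_compose cl pc_proj_continuous.
  - by move=> t /sublink_above; rewrite pc_projE; exact: Al.
  - by rewrite l0.
  - by rewrite l1 H_at_proj.
by exists g; split=> //; exists l; split=> // t _; rewrite /= pc_projE.
Qed.

Lemma rho_subproof (x : @pi1 R M A base) : exists v, monodromy (val (repr x)) v.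
Proof. exact: monodromy_exists (loopP (repr x)). Qed.

Definition rho (x : @pi1 R M A base) : 'F_p := sval (cid (rho_subproof x)).

Lemma rhoE c (cP : is_path A (val base) (val base) c) v : monodromy c v ->
  rho (loop_class cP) = v.
Proof.
move=> cv; have rv := svalP (cid (rho_subproof (loop_class cP))).
have Ac : forall t, A (c t) by case: (cP).
apply: (monodromy_unique (c := c)) cv => //.
apply: monodromy_homotopic rv; first exact: loopP (repr _).
apply/(loop_classP (loopP (repr (loop_class cP))) cP).
exact: (loop_class_repr (loop_class cP)).
Qed.

Lemma rhoM : {morph rho : x y / (x * y)%g >-> x + y}.
Proof.
move=> x y; rewrite -(loop_class_repr x) -(loop_class_repr y).
have [cP dP] := (loopP (repr x), loopP (repr y)).
have [v cv] := monodromy_exists cP; have [w dw] := monodromy_exists dP.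
rewrite (rhoE (loopP (repr x)) cv) (rhoE (loopP (repr y)) dw).
rewrite [(_ * _)%g]pi1_mulE; apply: rhoE.
exact: monodromy_cat.
Qed.

Lemma rho_onto : prime p -> (exists g, phi g <> 0) -> range rho = setT.
Proof.
move=> pp phi0; apply/seteqP; split=> // v _.
have [g <-] := phi_onto v pp phi0; have [c cP cg] := monodromy_onto g.
by exists (loop_class (cP : is_path A (val base) (val base) c)) => //; exact: rhoE.
Qed.

(* The Frobenius [g] carries the start [y] of a lift of the knot to its end;  *)
(* conjugating by [u], we may start the lift on the prescribed component.     *)
Lemma frobenius_stab j v (x : @pi1 R M A base) Cbar : (n <= j)%N ->
  @knot_class R M A base (K' j) x -> rho x = v ->
  component_above L q (range (K' j)) Cbar ->
  exists2 g : H, stab_set Cbar g & phi g = v.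
Proof.
move=> nj [tau [[ctau Atau tau0 tau1] [cP ->]]] xv [Cknot Ct qC].
have [v' cv'] := monodromy_exists cP.
have {xv} vE : v = v' by rewrite -xv; exact: rhoE.
subst v'; have [g [lg gv]] := cv'.
(* Since [n <= j], this knot lies over none of the first [m] knots, so it is unramified in all
   covers at hand. *)
have mij : (m <= i j)%N by rewrite leqNgt; apply/negP => /nP; rewrite ltnNge nj.
have gen w : range (L (i j)) w -> ~ sublink L m w.
  by move=> jw [a /= am aw]; move: am; rewrite (knot_index tL aw jw) ltnNge mij.
have [[ck kP] f0 kE] := covK j.
have kL t : range (L (i j)) (h (K' j t)).
  by apply: (preimage_knot_range covK); exists t.
have k10 : K' j 1 = K' j 0 by apply/kP; rewrite subr0 rpred1.
have gk t : ~ sublink L m (h (K' j t)) by exact: gen.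
have gtau t : ~ sublink L m (h (tau t)) by exact: sublink_below.
have fcX := cover_finite_covering hZ tL km.
(* The loop is lifted in three pieces: [tau] from [x0] to [y], the knot from [y] to [y'], and [tau]
   reversed from [y'] to [z]. *)
have [||y ly] := lifts_to_exists fcX (c := h \o tau) (x := x0) _ gtau.
- exact: h_path_continuous.
- by rewrite /= tau0 pc_projE.
have [lt [clt lt0 lt1 hlt]] := ly.
have ry : r y = K' j 0.
  by rewrite -lt1 (lift_proj ctau clt) ?tau1 ?lt0 ?tau0 ?lexx ?ler01.
have [||y' ly'] := lifts_to_exists fcX (c := h \o K' j) (x := y) _ gk.
- exact: h_path_continuous.
- by rewrite /= -ry pc_projE.
have [lk [clk lk0 lk1 hlk]] := ly'.
have [|||z lz] := lifts_to_exists fcX (c := path_rev (h \o tau)) (x := y').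
- have [] := is_path_rev (A := setT) (x := h (tau 0)) (y := h (tau 1))
    (c := h \o tau) => //.
  by split=> //; exact: h_path_continuous.
- by move=> t; exact: gtau.
- by rewrite -lk1 hlk ?lexx ?ler01 // /path_rev subr0 /= k10 tau1.
(* Both points end a lift of [tau] from [H_at g x0]: one is the translate of the first piece, the
   other the reverse of the third. *)
have gyy' : H_at g y = y'.
  have zE : z = H_at g x0.
    apply: (lifts_to_unique (cover_hausdorff km) fcX _ _ lg).
      by move=> t; apply: sublink_below; case: cP.
    by rewrite !comp_path_cat; apply: lifts_to_cat lz; exact: lifts_to_cat ly ly'.
  have := lifts_to_rev lz; rewrite path_revK zE => lz'.
  apply: (lifts_to_unique (cover_hausdorff km) fcX _ _ lz') => //.
  exact: lifts_to_translate.
have [y2 Cy2 ry2] : exists2 y2, Cbar k y2 & r y2 = r y.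
  have : range (K' j) (K' j 0) by exists 0.
  rewrite -qC -(Ct _ _ ik) => -[_ [y2 Cy2 <-] qy2].
  by exists y2 => //; rewrite ry; exact: qy2.
have gy : ~ sublink L m (pk y) by rewrite -pc_projE ry.
have [u uy] := H_transitive gy (esym ry2).
pose g' := (u * g * u^-1)%g.
have phig' : phi g' = v.
  by rewrite /g' !phiM addrAC -phiM mulgV phi1 add0r.
have g'y2 : H_at g' y2 = H_at u y'.
  by rewrite /g' !H_atM -uy -(H_atM u^-1%g) mulVg H_at1 gyy'.
have [a [w [aw CE]]] := Cknot k.
have y2L : range (L (i j)) (pk y2) by rewrite -pc_projE ry2 ry.
have ja : i j = a.
  apply: (knot_index tL y2L); move: Cy2; rewrite CE.
  exact: connected_component_sub.
have CkE : Cbar k = connected_component (pk @^-1` range (L (i j))) y2.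
  by rewrite ja CE; apply: same_connected_component; rewrite -CE.
(* The translate by [u] of the lifted knot is a connected path over the knot from [y2] to this
   point. *)
have Cuy' : Cbar k (H_at u y').
  rewrite CkE; pose lc := H_at u \o (lk \o @clamp R).
  have clc : continuous lc.
    apply: continuous_compose (@H_at_continuous u).
    exact: continuous_compose (@clamp_continuous R) clk.
  have sub : range lc `<=` connected_component (pk @^-1` range (L (i j))) y2.
    apply: connected_component_max.
    - by exists 0 => //; rewrite /lc /= clamp0 lk0 uy.
    - move=> _ [t _ <-]; rewrite /lc /preimage /= H_at_map.
      rewrite hlk; last exact: clamp_itv.
      exact: kL.
    - apply: connected_continuous_connected; first exact: connected_real.
      exact: continuous_subspaceT.
  by apply: sub; exists 1 => //; rewrite /lc /= clamp1 lk1.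
have g'C : H_at g' @` Cbar k = Cbar k.
  have [cg' pg' [gi [cgi giK giK']]] := H_at_deck g'.
  apply: (homeo_component cg' cgi giK giK' _ CkE Cy2); last by rewrite g'y2.
  by move=> s; rewrite /preimage /= pg'.
have genC s : Cbar k s -> ~ sublink L m (pk s).
  by rewrite CkE => /connected_component_sub; exact: gen.
have [gh [ghk ghC]] := Gal_stab_extend hZ tL PU km Cknot Ct genC (H_at_deck g') g'C.
have Hgh : over_set q gh.
  by apply: (over_of_deck gy); rewrite ghk; exact: H_at_proj.
exists (exist (fun g => g \in subgroup_set (Gal_over q)) gh (mem_set Hgh)) => //.
by rewrite -phig'; apply: (phi_eq gy); rewrite {1}/H_at /= ghk.
Qed.

End Monodromy.

(** Were [phi] nonzero, [rho] would be onto, and a knot of [L'] would have a Frobenius in its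
    decomposition group on which [phi] is 1. *)
Lemma character_vanishes (R : realType) (Z M : topologicalType)
    (L : nat -> R -> Z) (h : M -> Z) (P : pro_cover Z) (i0 : pc_index P)
    (q : pc_space P i0 -> M) (Kbar : set M -> forall i, set (pc_space P i))
    (L' : set (set M)) (p : nat) (phi : subgroup_type (Gal_over q) -> 'F_p) :
  hausdorff_space Z -> tame_link L -> stably_chebotarev L ->
  universal_pro_cover L P -> cov L h -> continuous q ->
  (forall x, h (q x) = pc_map P i0 x) ->
  (forall C, knot_components L h C -> component_above L q C (Kbar C)) ->
  finite_set (knot_components L h `\` L') -> prime p ->
  continuous (phi : _ -> discrete_topology 'F_p) ->
  {morph phi : x y / (x * y)%g >-> x + y} ->
  (forall C, L' C -> forall g, stab_set (Kbar C) g -> phi g = 0) ->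
  forall g, phi g = 0.
Proof.
move=> hZ tL [_ stL] PU hcov q_cont q_over Kabove L'fin pp cphi phiM phi0 g.
apply: contrapT => phig.
have phi_ne : exists g, phi g <> 0 by exists g.
have [K' [i [f [d [bijK covK _ _]]]] chebK] := stL M h hcov.
have [k ik phi_k] := Gal_level hZ tL PU i0 cphi.
have [mh hmh] := cov_branched hcov.
have [mk [i0mk kmk]] := pc_branched2 PU i0 k.
pose m := maxn mh mk.
have hm : branched_upto L h m by exact: branched_uptoW (leq_maxl _ _) hmh.
have i0m : branched_upto L (pc_map P i0) m.
  exact: branched_uptoW (leq_maxr _ _) i0mk.
have km : branched_upto L (pc_map P k) m.
  exact: branched_uptoW (leq_maxr _ _) kmk.
have [n nP] := preimage_knots_over hZ tL bijK covK m hm.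
pose m' := maxn m (\max_(j < n) (i j).+1).
have mm' : (m <= m')%N by exact: leq_maxl.
have m'P j : (j < n)%N -> (i j < m')%N.
  move=> jn; rewrite leq_max; apply/orP; right.
  exact: (leq_bigmax (F := fun j : 'I_n => (i j).+1) (Ordinal jn)).
have [x0 gx0] := generic_exists hZ tL (branched_uptoW mm' km).
pose b := base PU q_over ik covK m'P gx0.
pose rh (x : @pi1 R M (~` sublink K' n) b) : 'F_p :=
  rho hZ tL q_cont hm i0m km phi bijK nP mm' x.
have rM : {morph rh : x y / (x * y)%g >-> (x * y)%g}.
  by move=> x y; rewrite FinRing.zmodMgE; exact: rhoM.
have rS : range rh = setT by exact: rho_onto.
(* The class of the residue 1, which is not neutral: the group law of ['F_p] is addition. *)
pose C : {set 'F_p} := ((1%R : 'F_p) ^: [set: 'F_p]%SET)%g.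
have CP : C \in classes [set: 'F_p]%SET by apply: mem_classes; rewrite finset.inE.
have := chebK n b _ rh rM rS C CP.
move=> /positive_density_often often.
have oneC : (1%R : 'F_p) \in C by exact: class_refl.
have fin : finite_set [set j | ~ L' (range (K' j))].
  apply: (@sub_finite_set _ _
    ((fun j => range (K' j)) @^-1` (knot_components L h `\` L'))).
    by move=> j nL; split=> //; have [fK _ _] := bijK; exact: fK.
  apply: finite_preimage L'fin => j j' _ _.
  by have [_ injK _] := bijK; apply: injK; rewrite ?classical_sets.inE.
have [N NP] := finite_nat_bound fin.
(* An index beyond [n] makes the knot unramified, and beyond [N] puts it in [L']. *)
have [|j /andP[nj Nj] /asboolP rj] := often _ N.
  by rewrite divr_gt0 // ltr0n; apply/card_gt0P; exists 1.
have : [set` C] 1 by [].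
rewrite -rj => -[x xj rx].
have L'j : L' (range (K' j)).
  by apply: contrapT => /NP; rewrite ltnNge Nj.
have cj : knot_components L h (range (K' j)) by have [fK _ _] := bijK; exact: fK.
have [g1 /(phi0 _ L'j) -> /esym/eqP] :=
  frobenius_stab phiM phi_k nj xj rx (Kabove _ cj).
by rewrite oner_eq0.
Qed.

Theorem theorem3 (R : realType) (L : nat -> R -> sphere3 R)
    (L_tame : tame_link L) (L_stable : stably_chebotarev L)
    (P : pro_cover (sphere3 R)) (P_univ : universal_pro_cover L P)
    (M : topologicalType) (h : M -> sphere3 R) (h_cov : cov L h)
    (i0 : pc_index P) (q : pc_space P i0 -> M) (q_cont : continuous q)
    (q_over : forall x, h (q x) = pc_map P i0 x)
    (Kbar : set M -> forall i, set (pc_space P i))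
    (Kbar_above : forall K, knot_components L h K ->
       component_above L q K (Kbar K))
    (L' : set (set M)) (L'_sub : L' `<=` knot_components L h)
    (L'_cofinite : finite_set (knot_components L h `\` L'))
    (p : nat) (p_prime : prime p) :
  injective (fun (c : @H1 (subgroup_type (Gal_over q)) 'F_p (trivial_action 'F_p))
                 (K : L') =>
    (res1 (stabilizer (Gal_over q) (Kbar (val K))) c
      : @H1 (subgroup_type (stabilizer (Gal_over q) (Kbar (val K)))) 'F_p
          (trivial_action 'F_p))).
Proof.
elim/quotW => f1; elim/quotW => f2 E; apply/eqP.
(* The action being trivial, the two classes agree once [f1 - f2], a continuous homomorphism,
   vanishes pointwise. *)
rewrite -Quotient.idealrBE; apply/asboolP; exists 0 => x; rewrite subrr.
have /asboolP[cf fM] := valP (f1 - f2); move: x.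
apply: (character_vanishes (@sphere3_hausdorff R) L_tame L_stable P_univ h_cov
  q_cont q_over Kbar_above L'_cofinite p_prime cf fM) => C L'C g gC.
pose K : L' := exist (fun C => C \in L') C (mem_set L'C).
have := congr1 (fun F => F K) E; rewrite !res1E => /eqP.
rewrite -Quotient.idealrBE => /asboolP[a aE].
(* Equal restrictions differ by a coboundary, whose values [a - a] are zero. *)
exact: etrans (aE (exist (fun g => g \in subgroup_set
  (stabilizer (Gal_over q) (Kbar C))) g (mem_set gC))) (subrr a).
Qed.
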